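(* Assume that $$\mathbf{Q_1}=\sup_{i\in F^*}\sum_{j\in F^*,\,j\ne i}Q_{i,j}<+\infty\quad\text{and}\quad \mathbf{p}=\sup_{i\in F^*}p_0(i)<+\infty.$$ Then there exist constants $B,C>0$, which do not depend on $N$ and $t$, such that for all $N\ge 2$, all $t\ge 0$, all $\eta\in E^{(N)}$ and every probability measure $\mu$ on $F^*$, $$\sup_{\|\varphi\|_\infty\le 1}\mathbb{E}_\eta\big[\,|m(\eta_t)(\varphi)-\mu T_t\varphi|\,\big]\le C e^{Bt}\Big(\frac{1}{\sqrt N}+d_{\mathrm{TV}}(m(\eta),\mu)\Big),$$ where the supremum is over functions $\varphi:F^*\to\mathbb{R}$ with $\|\varphi\|_\infty\le 1$ and $(\eta_t)_{t\ge0}$ is the Fleming-Viot process with $N$ particles.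
   Context: $F^*$ is a (finite or infinite) countable discrete set, and $(Q_{i,j})_{i,j\in F^*}$ is the transition rate matrix of an irreducible, positive recurrent continuous-time Markov process on $F^*$. The function $p_0:F^*\to[0,\infty)$ (death rate) is not identically zero. $F=F^*\cup\{0\}$ with $0\notin F^*$. Conditioned semigroup: let $(P_t)_{t\ge0}$ be the semigroup on $F$ of the Markov process with generator $Gf(i)=p_0(i)(f(0)-f(i))+\sum_{j\in F^*}Q_{i,j}(f(j)-f(i))$ for $i\in F^*$ and $Gf(0)=0$ (so $0$ is absorbing). For a probability measure $\mu$ on $F^*$, $\mu T_t$ is the law at time $t$ of this process started from $\mu$ and conditioned on non-absorption up to time $t$: for $f$ on $F^*$, with the convention $f(0)=0$, $$\mu T_t f=\frac{\sum_{y\in F^*}P_tf(y)\mu(y)}{\sum_{y\in F^*}P_t\mathbf{1}_{\{0\}^c}(y)\mu(y)}.$$ Fleming-Viot process: for an integer $N\ge 2$, $E=E^{(N)}=\{\eta:F^*\to\mathbb{N}:\sum_{i\in F^*}\eta(i)=N\}$. $T_{i\to j}\eta$ is obtained from $\eta$ by moving one particle from $i$ to $j$ (when $\eta(i)\ne0$), i.e. decreasing $\eta(i)$ by 1 and increasing $\eta(j)$ by 1. The Fleming-Viot process $(\eta_t)_{t\ge0}$ with $N$ particles is the Markov process on $E$ with generator $$\mathcal{L}f(\eta)=\sum_{i\in F^*}\eta(i)\sum_{j\in F^*}\big(f(T_{i\to j}\eta)-f(\eta)\big)\Big(Q_{i,j}+p_0(i)\frac{\eta(j)}{N-1}\Big).$$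 $\mathbb{E}_\eta$ denotes expectation given $\eta_0=\eta$. The empirical distribution is $m(\eta)=\frac1N\sum_{k\in F^*}\eta(k)\delta_{\{k\}}$ and $m(\eta)(\varphi)=\sum_{j\in F^*}\varphi(j)m(\eta)(\{j\})$. Total variation distance: $d_{\mathrm{TV}}(\mu,\mu')=\frac12\sup_{\|f\|_\infty\le1}(\int f\,d\mu-\int f\,d\mu')$. *)

(* Defs.v *)
From HB Require Import structures.
From mathcomp Require Import all_boot all_order all_algebra.
From mathcomp Require Import finmap multiset.
From mathcomp Require Import all_classical all_reals all_analysis.

Set Implicit Arguments.
Unset Strict Implicit.
Unset Printing Implicit Defensive.

Import Order.TTheory GRing.Theory Num.Theory.
Import numFieldNormedType.Exports.

Local Open Scope classical_set_scope.
Local Open Scope ring_scope.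

(** Sums over a countable set are integrals against the counting measure:
    [\int[counting]_x a x] is \sum_x a x for an absolutely summable [a]. *)

Section continuous_time_markov.
Context {R : realType} {d : measure_display} {S : measurableType d}.
Implicit Types (P : R -> R.-pker S ~> S) (A : (S -> R) -> S -> R).

Definition bounded_by1 {T : Type} : set (T -> R) :=
  [set f | forall x, `|f x| <= 1].

Definition sg_apply P (t : R) (f : S -> R) (x : S) : R :=
  (\int[P t x]_y f y)%R.

(** Only the values of [P] at nonnegative times matter. *)
Record markov_semigroup A P : Prop := {
  sg_zero : forall x B, P 0 x B = \d_x B ;
  sg_add : forall s t, 0 <= s -> 0 <= t ->
    forall x B, measurable B ->
      P (s + t)%R x B = (\int[P s x]_y P t y B)%E ;
  sg_generator : forall f : S -> R, (exists c, forall x, `|f x| <= c) ->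
    forall x, (fun h => h^-1 * (sg_apply P h f x - f x)) @ 0^'+ --> A f x }.

(** Time-homogeneous Markov property (on a countable discrete [S] it is enough
    to condition on finitely many values of the past), together with
    right-continuity of the paths for the discrete topology. *)
Record markov_jump_process P {d' : measure_display} {Omega : measurableType d'}
    (Pr : probability Omega R) (X : R -> {mfun Omega >-> S}) : Prop := {
  mjp_markov : forall n (r : 'I_n -> R) (z : 'I_n -> S) (s t : R) (x y : S),
    (forall k, 0 <= r k <= s) -> 0 <= s <= t ->
    let past := [set w | forall k, X (r k) w = z k] `&` [set w | X s w = x] in
    Pr (past `&` [set w | X t w = y]) = (Pr past * P (t - s)%R x [set y])%E ;
  mjp_right_continuous : forall w (t : R), 0 <= t ->
    \forall s \near t^'+, X s w = X t w }.

Definition started_at {d' : measure_display} {Omega : measurableType d'}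
    (Pr : probability Omega R) (X : R -> {mfun Omega >-> S}) (x : S) : Prop :=
  Pr [set w | X 0 w = x] = 1%E.

Definition irreducible P : Prop :=
  forall x y, exists2 t, 0 <= t & (0 < P t x [set y])%E.

(** First return to [x] after having left [x]; +oo if there is none. *)
Definition return_time {Omega : Type} (X : R -> Omega -> S) (x : S)
    (w : Omega) : \bar R :=
  ereal_inf [set t%:E | t in
    [set t | (exists2 s, 0 <= s <= t & X s w <> x) /\ X t w = x]].

(** Absorbing states count as positive recurrent, as usual. *)
Definition positive_recurrent_state P (x : S) : Prop :=
  (forall t, 0 <= t -> P t x [set x] = 1%E) \/
  exists (d' : measure_display) (Omega : measurableType d')
         (Pr : probability Omega R) (X : R -> {mfun Omega >-> S}),
    [/\ markov_jump_process P Pr X, started_at Pr X x &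
        (\int[Pr]_w return_time (fun t w' => X t w') x w < +oo)%E].

Definition positive_recurrent P : Prop :=
  forall x, positive_recurrent_state P x.

(** Meant for a discrete [S], where every function is measurable. *)
Definition dTV (mu nu : {measure set S -> \bar R}) : \bar R :=
  (2^-1%:E * ereal_sup [set ((\int[mu]_x f x)%R - (\int[nu]_x f x)%R)%:E
                       | f in bounded_by1])%E.

End continuous_time_markov.

Section rates.
Context {R : realType} {d : measure_display} {F : measurableType d}.
Implicit Types Q : F -> F -> R.

Definition exit_rate Q (i : F) : \bar R :=
  (\int[counting]_(j in [set j | j != i]) (Q i j)%:E)%E.

Record transition_rate_matrix Q : Prop := {
  rate_ge0 : forall i j, i != j -> 0 <= Q i j ;
  rate_diag : forall i, exit_rate Q i = (- Q i i)%:E }.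

Definition rate_generator Q (f : F -> R) (i : F) : R :=
  (\int[counting]_j (Q i j * (f j - f i)))%R.

End rates.

(** [F* ∪ {0}]: the absorbing point 0 is [None]. *)
Definition with_cemetery (F : Type) : Type := option F.

Section cemetery_measurable.
Context {d : measure_display} {F : measurableType d}.
Local Notation F0 := (with_cemetery F).

Definition cemetery_measurable : set (set F0) :=
  [set A | measurable (@Some F @^-1` A)].

Let measurable0 : cemetery_measurable set0.
Proof. by rewrite /cemetery_measurable/= preimage_set0. Qed.

Let measurableC A : cemetery_measurable A -> cemetery_measurable (~` A).
Proof.
by rewrite /cemetery_measurable/= => mA; rewrite preimage_setC; exact: measurableC.
Qed.

Let measurable_bigcup (A : (set F0)^nat) :
  (forall i, cemetery_measurable (A i)) ->
  cemetery_measurable (\bigcup_i A i).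
Proof.
rewrite /cemetery_measurable/= => mA.
by rewrite preimage_bigcup; exact: bigcup_measurable.
Qed.

HB.instance Definition _ := Choice.copy F0 (option F).
HB.instance Definition _ := isPointed.Build F0 None.
HB.instance Definition _ := isMeasurable.Build d F0
  measurable0 measurableC measurable_bigcup.

End cemetery_measurable.

Section conditioned_semigroup.
Context {R : realType} {d : measure_display} {F : measurableType d}.
Local Notation F0 := (with_cemetery F).

Definition absorbed_generator (Q : F -> F -> R) (p0 : F -> R)
    (f : F0 -> R) (x : F0) : R :=
  match x with
  | None => 0
  | Some i => p0 i * (f None - f (Some i)) +
              (\int[counting]_(j in [set: F]) (Q i j * (f (Some j) - f (Some i))))%R
  end.

Definition ext0 (f : F -> R) (x : F0) : R :=
  if x is Some i then f i else 0.

(** mu T_t f, for [P] the semigroup of the absorbed process. *)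
Definition conditioned (P : R -> R.-pker F0 ~> F0)
    (mu : probability F R) (t : R) (f : F -> R) : R :=
  (\int[mu]_y sg_apply P t (ext0 f) (Some y))%R /
  (\int[mu]_y sg_apply P t \1_(~` [set None]) (Some y))%R.

End conditioned_semigroup.

(** [E^(N)]: functions F* -> nat of total mass [N]; such a function has finite
    support, i.e. it is a finite multiset. *)
Record config (F : choiceType) (N : nat) := Config {
  occ :> {fsfun F -> nat with 0%N} ;
  _ : (\sum_(i <- finsupp occ) occ i == N)%N }.

HB.instance Definition _ (F : choiceType) N := [isSub for @occ F N].
HB.instance Definition _ (F : choiceType) N := [Choice of config F N by <:].

(** T_(i -> j) eta, with value [eta] when there is no particle at [i]. *)
Definition move {F : choiceType} {N : nat} (i j : F) (eta : config F N) :
    config F N :=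
  insubd eta (j +` ((occ eta : multiset F) `\ i))%mset.

Lemma size_mset1D (F : choiceType) (a : F) (m : multiset F) :
  size (a +` m)%mset = (size m).+1.
Proof.
have -> : (a +` m)%mset = seq_mset (a :: m).
  by apply/msetP => b; rewrite mset1DE mset_seqE/= count_mem_mset eq_sym.
by rewrite (perm_size (perm_eq_seq_mset _)).
Qed.

Lemma moveE (F : choiceType) N (i j : F) (eta : config F N) (k : F) :
  eta i != 0%N -> move i j eta k = ((k == j) + (eta k - (k == i)))%N.
Proof.
move=> eta_i; rewrite /move -/(val _) insubdK ?mset1DE ?msetB1E//.
case: eta eta_i => m /= mN mi; rewrite -topredE/=.
have im : i \in (m : multiset F) by rewrite -mset_neq0.
have := mN; rewrite -!(@size_mset F) size_mset1D.
by rewrite -[X in size (EnumMset.f X) == _ -> _](msetB1K im) size_mset1D.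
Qed.

Section configurations.
Context {R : realType} {d : measure_display} {F : measurableType d} {N : nat}.
Local Notation E := (config F N).

Let point_subproof :
  (\sum_(i <- finsupp (msetn N (point : F))) msetn N (point : F) i == N)%N.
Proof. by rewrite -size_mset enum_msetn size_nseq. Qed.

HB.instance Definition _ := isPointed.Build E (Config point_subproof).
HB.instance Definition _ := @isMeasurable.Build default_measure_display E
  discrete_measurable discrete_measurable0
  discrete_measurableC discrete_measurableU.

Definition empirical (eta : E) (A : set F) : \bar R :=
  ((N%:R^-1)%:E * \sum_(k <- finsupp eta) (eta k)%:R%:E * \d_k A)%E.

Lemma empirical_msum (eta : E) (s := enum_fset (finsupp (occ eta))) :
  empirical eta = mscale ((N%:R : R)^-1)%:nng
    (msum (fun n => mscale (eta (nth point s n))%:R%:nng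
                           \d_(nth point s n)) (size s)).
Proof.
apply/funext => A; rewrite /empirical /mscale/= /msum/=; congr (_ * _)%E.
by rewrite (big_nth point) big_mkord; apply: eq_bigr => i _.
Qed.

Let empirical0 eta : empirical eta set0 = 0%E.
Proof. by rewrite empirical_msum measure0. Qed.

Let empirical_ge0 eta A : (0 <= empirical eta A)%E.
Proof. by rewrite empirical_msum measure_ge0. Qed.

Let empirical_sigma_additive eta : semi_sigma_additive (empirical eta).
Proof. by rewrite empirical_msum; exact: measure_semi_sigma_additive. Qed.

HB.instance Definition _ eta := isMeasure.Build _ _ _ (empirical eta)
  (empirical0 eta) (empirical_ge0 eta) (@empirical_sigma_additive eta).

Definition fv_generator (Q : F -> F -> R) (p0 : F -> R)
    (f : E -> R) (eta : E) : R :=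
  (\int[counting]_(i in [set: F]) ((eta i)%:R *
     \int[counting]_(j in [set: F]) ((f (move i j eta) - f eta) *
        (Q i j + p0 i * (eta j)%:R / N.-1%:R))))%R.

Definition fleming_viot (Q : F -> F -> R) (p0 : F -> R)
    {d' : measure_display} {Omega : measurableType d'}
    (Pr : probability Omega R) (X : R -> {mfun Omega >-> E}) : Prop :=
  exists2 P : R -> R.-pker E ~> E,
    markov_semigroup (fv_generator Q p0) P & markov_jump_process P Pr X.

End configurations.

(* Main.v *)
Require Import Defs.
From HB Require Import structures.
From mathcomp Require Import all_boot all_order all_algebra.
From mathcomp Require Import finmap multiset.
From mathcomp Require Import all_classical all_reals all_analysis.
From mathcomp Require Import ring lra.
Set Implicit Arguments.
Unset Strict Implicit.
Unset Printing Implicit Defensive.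
Import Order.TTheory GRing.Theory Num.Theory.
Import numFieldNormedType.Exports.
Local Open Scope classical_set_scope.
Local Open Scope ring_scope.

(** Let [c = mu T_t phi] and let [psi] be [phi - c] on F*, extended by 0, so that
    [mu (P_t psi) = 0] and [m(eta_t)(phi) - c = m(eta_t)(psi)]. With
    [f_r = P_r psi], the second moment [u(s) = E_eta [m(eta_s)(f_(t-s))^2]]
    satisfies [u' <= 2 p u + O(1/N)]: the linear parts of the two generators
    cancel, the killing and rebirth of particles leave the term [2 m(p_0) m(f)^2],
    and the rest is O(1/N). As [u(0) <= 16 d_TV(m(eta), mu)^2], Gronwall's
    lemma bounds [u(t) = E_eta [m(eta_t)(psi)^2]], and Cauchy-Schwarz concludes. *)

(** The obstacle is uniformity. A generator is given only through a right derivative at time 0, for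
    one function and one starting point at a time, while [u] averages over all configurations and
    uses a test function that itself moves with time. Bounded rates repair this. The probability of
    sitting at [x] is supermultiplicative in time, so the derivative at 0 bounds the exit
    probability at all times; two applications of this bound give [P_h f = f + h A f + O(h^2)], with
    an error uniform in [x] that depends on [f] only through its supremum. Hence [u] is never
    differentiated: a one-step inequality with an [O(h^2)] error is iterated. For the particle
    system that error involves the total jump rate, of order N, but it disappears as the mesh goes
    to 0, so the constants stay free of N. Centring matters as well: it replaces the nonlinear flow
    [mu T_t] by the linear semigroup, whose contraction keeps every [f_r] bounded by 2. *)

Section gronwall.
Context {R : realType}.

(** A one-sided Euler estimate that is uniform in [s] needs no regularity of
    [u]: it can be iterated along a regular subdivision of [[0, t]]. *)
Lemma gronwall_euler (u : R -> R) (k K t : R) :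
  0 <= k -> 0 <= K -> 0 <= t -> 0 <= u 0 ->
  (forall e, 0 < e -> exists2 h0, 0 < h0 &
    forall s h, 0 <= s -> 0 < h -> h <= h0 -> s + h <= t ->
      u (s + h) <= u s + h * (k * u s + K + e)) ->
  u t <= expR (k * t) * (u 0 + K * t).
Proof.
move=> k0 K0 t0 u0 H; rewrite le_eqVlt in t0.
case/orP: t0 => [/eqP <-|t0]; first by rewrite !mulr0 addr0 expR0 mul1r.
apply/ler_addgt0Pr => e e0.
have ekt0 : 0 < expR (k * t) * t by rewrite mulr_gt0// expR_gt0.
(* Over the whole subdivision a local error [e'] accumulates to at most [expR (k * t) * t * e'];
   this choice makes that equal to [e]. *)
have [|h0 h00 Hh] := H (e / (expR (k * t) * t)); first by rewrite divr_gt0.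
set e' := e / _ in Hh.
have e'0 : 0 < e' by rewrite divr_gt0.
have [n nt] : exists n : nat, t / h0 < n.+1%:R.
  exists (Num.truncn (t / h0)); exact: truncnS_gt.
pose h := t / n.+1%:R.
have hpos : 0 < h by rewrite divr_gt0.
have hh0 : h <= h0.
  by rewrite ler_pdivrMr// mulrC -ler_pdivrMr// ltW.
have nh : n.+1%:R * h = t by rewrite mulrC divfK.
have kh0 : 0 <= k * h by rewrite mulr_ge0// ltW.
have step j : (j <= n.+1)%N ->
    u (j%:R * h) <= (1 + k * h) ^+ j * (u 0 + j%:R * h * (K + e')).
  elim: j => [_|j IH jn]; first by rewrite !mul0r addr0 expr0 mul1r.
  have E : j.+1%:R * h = j%:R * h + h by rewrite -natr1 mulrDl mul1r.
  rewrite E; apply: (le_trans (Hh _ _ _ hpos hh0 _)).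
  - by rewrite mulr_ge0// ltW.
  - by rewrite -E -nh ler_pM2r// ler_nat.
  have := IH (ltnW jn); set v := u (_ * h); set w := (1 + k * h) ^+ j => IHv.
  have w1 : 1 <= w * (1 + k * h).
    by rewrite -exprSr exprn_ege1// lerDl.
  have Ke' : 0 <= h * (K + e') by rewrite mulr_ge0 ?ltW// ltr_wpDl.
  rewrite exprSr -/w.
  have -> : v + h * (k * v + K + e') = v * (1 + k * h) + h * (K + e') by ring.
  have -> : w * (1 + k * h) * (u 0 + (j%:R * h + h) * (K + e')) =
    w * (u 0 + j%:R * h * (K + e')) * (1 + k * h) +
      w * (1 + k * h) * (h * (K + e')) by ring.
  apply: lerD; first by rewrite ler_wpM2r// ler_wpDr.
  by rewrite -[leLHS]mul1r ler_wpM2r.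
have := step n.+1 (leqnn _); rewrite nh => /le_trans; apply.
apply: (@le_trans _ _ (expR (k * t) * (u 0 + t * (K + e')))).
  apply: ler_wpM2r.
    by rewrite addr_ge0// mulr_ge0 ?ltW// ltr_wpDl.
  rewrite (_ : k * t = n.+1%:R * (k * h)); last by rewrite -nh; ring.
  by rewrite expRM_natl lerXn2r ?nnegrE ?expR_ge0 ?expR_ge1Dx// addr_ge0.
have -> : expR (k * t) * (u 0 + t * (K + e')) =
  expR (k * t) * (u 0 + K * t) + expR (k * t) * t * e' by ring.
by rewrite lerD2l /e' mulrC divfK// gt_eqF.
Qed.

End gronwall.

(** * Bounded integrals and semigroups on a discrete space *)

Section discrete_integral.
Context {R : realType} {d : measure_display} {S : measurableType d}.
Hypothesis S_discrete : forall A : set S, measurable A.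

Section unit_mass.
Variable mu : {measure set S -> \bar R}.
Hypothesis mu1 : mu [set: S] = 1%E.

Lemma discrete_integrable (f : S -> R) (c : R) :
  (forall x, `|f x| <= c) -> mu.-integrable [set: S] (EFin \o f).
Proof.
move=> fc; apply: measurable_bounded_integrable => //.
- by rewrite mu1 ltry.
- by exists c; split; [exact: num_real|move=> y cy x _; exact: le_trans (ltW cy)].
Qed.

Lemma Rintegral_mass1_cst (c : R) : (\int[mu]_x c)%R = c.
Proof. by rewrite Rintegral_cst// mu1 mulr1. Qed.

Lemma le_Rintegral_cst (f : S -> R) (a c : R) :
  (forall x, `|f x| <= a) -> (forall x, f x <= c) -> (\int[mu]_x f x)%R <= c.
Proof.
move=> fa fc; rewrite -[leRHS]Rintegral_mass1_cst; apply: le_Rintegral => //.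
- exact: discrete_integrable fa.
- exact: (@discrete_integrable _ `|c|).
Qed.

Lemma normr_Rintegral_le (f : S -> R) (c : R) :
  (forall x, `|f x| <= c) -> `|(\int[mu]_x f x)%R| <= c.
Proof.
move=> fc; apply: (le_trans (le_normr_Rintegral measurableT _)).
  exact: discrete_integrable fc.
by apply: (@le_Rintegral_cst _ c) => // x; rewrite normr_id.
Qed.

End unit_mass.

Section semigroup.
Variables (A : (S -> R) -> S -> R) (P : R -> R.-pker S ~> S).
Hypothesis P_sg : markov_semigroup A P.

Lemma sg_mass1 t x : P t x [set: S] = 1%E.
Proof. exact: prob_kernel. Qed.

Lemma normr_sg_apply_le t (f : S -> R) (c : R) x :
  (forall x, `|f x| <= c) -> `|sg_apply P t f x| <= c.
Proof. exact: (normr_Rintegral_le (sg_mass1 t x)). Qed.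

Lemma sg_apply_cst t (c : R) x : sg_apply P t (cst c) x = c.
Proof. exact: (Rintegral_mass1_cst (sg_mass1 t x)). Qed.

Lemma sg_applyB t (f g : S -> R) (a b : R) x :
  (forall x, `|f x| <= a) -> (forall x, `|g x| <= b) ->
  sg_apply P t (fun y => f y - g y) x = sg_apply P t f x - sg_apply P t g x.
Proof.
move=> fa gb; rewrite /sg_apply RintegralB//.
- exact: discrete_integrable (sg_mass1 t x) _ _ fa.
- exact: discrete_integrable (sg_mass1 t x) _ _ gb.
Qed.

Lemma sg_applyD t (f g : S -> R) (a b : R) x :
  (forall x, `|f x| <= a) -> (forall x, `|g x| <= b) ->
  sg_apply P t (fun y => f y + g y) x = sg_apply P t f x + sg_apply P t g x.
Proof.
move=> fa gb; rewrite /sg_apply RintegralD//.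
- exact: discrete_integrable (sg_mass1 t x) _ _ fa.
- exact: discrete_integrable (sg_mass1 t x) _ _ gb.
Qed.

Lemma sg_applyZ t (k : R) (f : S -> R) (a : R) x :
  (forall x, `|f x| <= a) ->
  sg_apply P t (fun y => k * f y) x = k * sg_apply P t f x.
Proof.
move=> fa; rewrite /sg_apply RintegralZl//.
exact: discrete_integrable (sg_mass1 t x) _ _ fa.
Qed.

Lemma le_sg_apply t (f g : S -> R) (a b : R) x :
  (forall x, `|f x| <= a) -> (forall x, `|g x| <= b) ->
  (forall x, f x <= g x) -> sg_apply P t f x <= sg_apply P t g x.
Proof.
move=> fa gb fg; rewrite /sg_apply le_Rintegral//.
- exact: discrete_integrable (sg_mass1 t x) _ _ fa.
- exact: discrete_integrable (sg_mass1 t x) _ _ gb.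
Qed.

Lemma sg_apply0 (f : S -> R) x : sg_apply P 0 f x = f x.
Proof.
rewrite /sg_apply /Rintegral (@eq_measure_integral _ _ _ _ (\d_x)); last first.
  by move=> B _ _; exact: (sg_zero P_sg).
by rewrite integral_dirac ?diracT ?mul1e//; by move=> _ ? _; exact: S_discrete.
Qed.

(** Chapman-Kolmogorov is given on sets. Viewing the right-hand side as a composed kernel extends it
    to nonnegative functions, and a bounded [f] becomes nonnegative after adding the constant
    [c]. *)
Lemma sg_apply_comp s t (f : S -> R) (c : R) x : 0 <= s -> 0 <= t ->
  (forall x, `|f x| <= c) ->
  sg_apply P (s + t) f x = sg_apply P s (sg_apply P t f) x.
Proof.
move=> s0 t0 fc.
have c0 : 0 <= c by exact: le_trans (fc x).
have ge0_case (g : S -> R) : (forall y, 0 <= g y) -> (forall y, `|g y| <= 2 * c) ->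
    sg_apply P (s + t) g x = sg_apply P s (sg_apply P t g) x.
  move=> g0 gc; rewrite /sg_apply /Rintegral.
  rewrite (@eq_measure_integral _ _ _ _ (mkcomp (P s) (kernel.kernel_snd (P t)) x)); last first.
    by move=> B mB _; exact: (sg_add P_sg).
  rewrite integral_kcomp//=.
  congr fine; apply: eq_integral => y _.
  rewrite fineK//; apply: integrable_fin_num => //.
  exact: discrete_integrable (sg_mass1 t y) _ _ gc.
have -> : f = (fun y => (f y + c) - cst c y) by apply/funext => y; rewrite addrK.
have gc y : `|f y + c| <= 2 * c.
  rewrite (le_trans (ler_normD _ _))// (ger0_norm c0).
  by rewrite mulr_natl mulr2n lerD2r.
have cc (y : S) : `|cst c y| <= c by rewrite /= ger0_norm.
rewrite (sg_applyB _ _ gc cc) sg_apply_cst ge0_case//; last first.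
  by move=> y; rewrite -lerBlDr sub0r; have := fc y; rewrite ler_norml => /andP[].
rewrite -[X in _ - X](sg_apply_cst s c x) -(@sg_applyB _ _ _ (2 * c) c)//.
  congr sg_apply; apply/funext => y /=.
  by rewrite (sg_applyB _ _ gc cc) sg_apply_cst.
by move=> y; exact: normr_sg_apply_le.
Qed.

End semigroup.

End discrete_integral.

(** * Uniform first and second order estimates under bounded exit rates *)

Section semigroup_expansion.
Context {R : realType} {d : measure_display} {S : measurableType d}.
Hypothesis S_discrete : forall A : set S, measurable A.
Variables (A : (S -> R) -> S -> R) (P : R -> R.-pker S ~> S).
Hypothesis P_sg : markov_semigroup A P.

Lemma normr_indic_le1 (B : set S) x : `|\1_B x : R| <= 1.
Proof. by rewrite indicE; case: (_ \in _); rewrite ?normr1 ?normr0. Qed.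

Lemma sg_generator_near (f : S -> R) (c e : R) x :
  (forall x, `|f x| <= c) -> 0 < e -> exists2 h0, 0 < h0 &
    forall h, 0 < h -> h <= h0 -> `|sg_apply P h f x - f x - h * A f x| <= h * e.
Proof.
move=> fc e0; have := @sg_generator _ _ _ _ _ P_sg _ (ex_intro _ c fc) x.
move/cvgrPdist_le => /(_ _ e0) [r /= r0 Hr].
exists (r / 2); first by rewrite divr_gt0.
move=> h h0 hr; have hne : h != 0 by rewrite gt_eqF.
have := Hr h; rewrite /ball /= sub0r normrN gtr0_norm// => /(_ _ h0).
have hlt : h < r by rewrite (le_lt_trans hr)// ltr_pdivrMr// ltr_pMr// ltr1n.
move=> /(_ hlt) H.
rewrite (_ : _ - _ - _ = - (h * (A f x - h^-1 * (sg_apply P h f x - f x)))).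
  by rewrite normrN normrM gtr0_norm// ler_pM2l.
by field.
Qed.

(** Being at [x] at time [s] and again [k] later is one way of being there at time [s + k], so the
    probability of sitting at [x] is supermultiplicative and [v] is subadditive. The derivative at 0
    thus controls every increment of [v], with a threshold on [k] independent of [s]. *)
Lemma sg_apply_exit_le (q h : R) x : 0 <= q -> 0 <= h ->
  - A \1_[set x] x <= q -> 1 - sg_apply P h \1_[set x] x <= q * h.
Proof.
move=> q0 h0 Aq; set f : S -> R := \1_[set x].
have f1 : forall y, `|f y| <= 1 by exact: normr_indic_le1.
have fx : f x = 1 by rewrite /f indicE mem_set.
pose v s := 1 - sg_apply P s f x.
have v0 : v 0 = 0 by rewrite /v (sg_apply0 S_discrete P_sg) fx subrr.
have := @gronwall_euler R v 0 q h; rewrite mul0r expR0 v0 add0r mul1r; apply => //.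
move=> e e0; have [r r0 Hr] := sg_generator_near x f1 e0.
exists r => // s k s0 k0 kr _.
have := Hr k k0 kr; rewrite fx ler_norml => /andP[vk _].
have vke : v k <= k * (q + e).
  have : k * - A f x <= k * q by rewrite ler_pM2l.
  by rewrite /v; lra.
rewrite mul0r add0r (le_trans _ (lerD (lexx _) vke))//.
have us := normr_sg_apply_le S_discrete P s x f1.
have uk := normr_sg_apply_le S_discrete P k x f1.
have us0 : 0 <= sg_apply P s f x by rewrite Rintegral_ge0.
have uk0 : 0 <= sg_apply P k f x by rewrite Rintegral_ge0.
rewrite (ger0_norm us0) in us; rewrite (ger0_norm uk0) in uk.
have : sg_apply P s f x * sg_apply P k f x <= sg_apply P (s + k) f x.
  rewrite (sg_apply_comp S_discrete P_sg _ s0 (ltW k0) f1) mulrC.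
  rewrite -(@sg_applyZ _ _ _ S_discrete _ _ _ _ 1)//.
  apply: (@le_sg_apply _ _ _ S_discrete _ _ _ _ (1) (1)) => [y|y|y].
  - by rewrite normrM (ger0_norm uk0) mulr_ile1.
  - exact: normr_sg_apply_le.
  - rewrite [X in _ * X]indicE; case: (boolP (y \in _)) => [/set_mem ->|_].
      by rewrite mulr1.
    by rewrite mulr0 Rintegral_ge0.
rewrite /v; nra.
Qed.

(** [|f - f x|] is at most [2 * c] and vanishes at [x], so only the mass that has left [x]
    counts. *)
Lemma normr_sg_applyB_le (f : S -> R) (c q h : R) x : 0 <= q -> 0 <= h ->
  (forall x, `|f x| <= c) -> - A \1_[set x] x <= q ->
  `|sg_apply P h f x - f x| <= 2 * c * q * h.
Proof.
move=> q0 h0 fc Aq; have c0 : 0 <= c by exact: le_trans (fc x).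
pose g y : R := 1 - \1_[set x] y.
have Eg : sg_apply P h g x = 1 - sg_apply P h \1_[set x] x.
  rewrite -[X in _ = X - _](sg_apply_cst S_discrete P h 1 x).
  by rewrite -(@sg_applyB _ _ _ S_discrete _ _ _ _ 1 1)// => y; rewrite ?normr1 ?normr_indic_le1.
have g01 y : 0 <= g y <= 1.
  by rewrite /g indicE; case: (_ \in _); rewrite ?subrr ?subr0 ?lexx ?ler01.
have g1 y : `|g y| <= 1 by have /andP[? ?] := g01 y; rewrite ger0_norm.
rewrite -[X in _ - X](sg_apply_cst S_discrete P h (f x) x).
rewrite -(@sg_applyB _ _ _ S_discrete _ _ _ _ c c)//; last by move=> y /=.
have fB y : `|f y - f x| <= 2 * c * g y.
  rewrite /g indicE; case: (boolP (y \in _)) => [/set_mem ->|_].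
    by rewrite !subrr normr0 mulr0.
  by rewrite subr0 mulr1 (le_trans (ler_normB _ _))// mulr_natl mulr2n lerD.
have fB2 y : `|f y - f x| <= 2 * c.
  by rewrite (le_trans (fB y))// ler_piMr ?mulr_ge0//; case/andP: (g01 y).
apply: (le_trans (le_normr_Rintegral measurableT _)).
  exact: (discrete_integrable S_discrete (sg_mass1 P h x) fB2).
apply: (@le_trans _ _ (sg_apply P h (fun y => 2 * c * g y) x)).
  apply: (@le_sg_apply _ _ _ S_discrete _ _ _ _ (2 * c) (2 * c)) => // y.
    by rewrite normr_id.
  have /andP[gy0 gy1] := g01 y.
  by rewrite ger0_norm ?mulr_ge0// ler_piMr ?mulr_ge0.
rewrite (@sg_applyZ _ _ _ S_discrete _ _ _ _ 1)// Eg -[leRHS]mulrA ler_wpM2l ?mulr_ge0//.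
exact: sg_apply_exit_le.
Qed.

(** The exit bound at every point makes [P_s f - f] of size [s] in supremum norm; a second use of it
    makes the increment of that function over a time [k] of size [s * k]. Summing over [[0, h]]
    leaves [h ^+ 2]. *)
Lemma normr_sg_expansion_le (f : S -> R) (c q h : R) x : 0 <= q -> 0 <= h ->
  (forall x, `|f x| <= c) -> (forall x, - A \1_[set x] x <= q) ->
  `|sg_apply P h f x - f x - h * A f x| <= 4 * c * q ^+ 2 * h ^+ 2.
Proof.
move=> q0 h0 fc Aq; have c0 : 0 <= c by exact: le_trans (fc x).
(* The Euler estimate is one-sided; the factor [o], taken to be 1 and -1, gives both signs. *)
suff H (o : R) : `|o| <= 1 ->
    o * (sg_apply P h f x - f x - h * A f x) <= 4 * c * q ^+ 2 * h ^+ 2.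
  have := H 1; have := H (-1); rewrite normrN1 normr1 => /(_ (lexx _)) H1 /(_ (lexx _)) H2.
  by rewrite ler_norml; lra.
move=> o1; pose w s := o * (sg_apply P s f x - f x - s * A f x).
have w0 : w 0 = 0 by rewrite /w (sg_apply0 S_discrete P_sg) subrr mul0r subr0 mulr0.
pose K := 4 * c * q ^+ 2 * h.
have K0 : 0 <= K by rewrite !mulr_ge0// sqr_ge0.
have := @gronwall_euler R w 0 K h; rewrite mul0r expR0 w0 add0r mul1r /K.
rewrite -[_ * h * h]mulrA -expr2; apply => //.
move=> e e0; have [r r0 Hr] := sg_generator_near x fc e0.
exists r => // s k s0 k0 kr skh; rewrite mul0r add0r.
pose g y := sg_apply P s f y - f y.
have gb y : `|g y| <= 2 * c * q * s by exact: normr_sg_applyB_le.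
have Pc y : `|sg_apply P s f y| <= c by exact: normr_sg_apply_le.
(* Writing [P_s f = f + g] splits the increment into a term quadratic in the times and the generator
   error at time 0 for the fixed [f], so no derivative of [P_s f] has to be controlled. *)
have E : sg_apply P (s + k) f x - sg_apply P s f x - k * A f x =
   (sg_apply P k g x - g x) + (sg_apply P k f x - f x - k * A f x).
  rewrite (addrC s) (sg_apply_comp S_discrete P_sg _ (ltW k0) s0 fc).
  rewrite (@sg_applyB _ _ _ S_discrete _ _ _ _ c c)// /g; lra.
have B1 := normr_sg_applyB_le q0 (ltW k0) gb (Aq x).
have B2 := Hr k k0 kr.
have -> : w (s + k) = w s + o * (sg_apply P (s + k) f x - sg_apply P s f x - k * A f x).
  by rewrite /w; ring.
rewrite lerD2l E (le_trans (ler_norm _))// normrM.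
apply: (@le_trans _ _ (1 * (2 * (2 * c * q * s) * q * k + k * e))).
  rewrite ler_pM// (le_trans (ler_normD _ _))// lerD//.
rewrite mul1r mulrDr lerD2r (_ : 2 * _ * q * k = 4 * c * q ^+ 2 * s * k); last by ring.
have sh : s <= h by lra.
rewrite mulrC; apply: ler_wpM2l; first exact: ltW.
by apply: ler_wpM2l; rewrite ?mulr_ge0 ?sqr_ge0.
Qed.

End semigroup_expansion.

(** * Integrals of finitely supported functions as finite sums *)

Section finitely_supported.
Context {R : realType} {d : measure_display} {F : measurableType d}.
Hypothesis F_discrete : forall A : set F, measurable A.

Lemma discrete_fun_sum_indic (s : seq F) (f : F -> R) : uniq s ->
  (forall x, x \notin s -> f x = 0) ->
  f = fun x => \sum_(k <- s) f k * \1_[set k] x.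
Proof.
move=> us fs; apply/funext => x; have [xs|xs] := boolP (x \in s).
  rewrite (bigD1_seq x)//= indicE mem_set// mulr1 big1 ?addr0// => k kx.
  by rewrite indicE memNset ?mulr0//= => xk; rewrite xk eqxx in kx.
rewrite fs// big_seq big1// => k ks; rewrite indicE memNset ?mulr0//= => xk.
by rewrite xk ks in xs.
Qed.

Variable mu : {measure set F -> \bar R}.

Lemma integrable_indic1 k : (mu [set k] < +oo)%E ->
  mu.-integrable [set: F] (fun x => (\1_[set k] x)%:E).
Proof.
move=> muk; apply/integrableP; split.
  by move=> _ ? _; exact: F_discrete.
rewrite (eq_integral (fun x => (\1_[set k] x)%:E)); last first.
  by move=> t _; rewrite gee0_abs// lee_fin.
by rewrite integral_indic// setIT.
Qed.

Lemma integrable_scale_indic1 k (c : R) : (mu [set k] < +oo)%E ->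
  mu.-integrable [set: F] (fun x => (c * \1_[set k] x)%:E).
Proof.
move=> muk; under eq_fun do rewrite EFinM.
by apply: integrableZl => //; exact: integrable_indic1.
Qed.

Lemma integrable_finite_support (s : seq F) (f : F -> R) : uniq s ->
  (forall k, k \in s -> (mu [set k] < +oo)%E) ->
  (forall x, x \notin s -> f x = 0) ->
  mu.-integrable [set: F] (EFin \o f).
Proof.
move=> us mus fs; rewrite (discrete_fun_sum_indic us fs).
rewrite (_ : _ \o _ = fun x => (\sum_(k <- s | k \in s) (f k * \1_[set k] x)%:E)%E).
  by apply: integrable_sum => // k ks; apply: integrable_scale_indic1; exact: mus.
by apply/funext => x; rewrite /= -sumEFin -big_seq.
Qed.

Lemma Rintegral_finite_support (s : seq F) (f : F -> R) : uniq s ->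
  (forall k, k \in s -> (mu [set k] < +oo)%E) ->
  (forall x, x \notin s -> f x = 0) ->
  (\int[mu]_x f x)%R = \sum_(k <- s) f k * fine (mu [set k]).
Proof.
move=> us mus fs; rewrite [in LHS](discrete_fun_sum_indic us fs).
elim: s us mus {fs} => [|a s IH] us mus.
  rewrite big_nil (_ : (fun _ => _) = cst 0).
    by rewrite /Rintegral integral0_eq.
  by apply/funext => x; rewrite big_nil.
have /andP[_ us'] := us.
under eq_Rintegral do rewrite big_cons.
rewrite RintegralD//.
- rewrite big_cons IH//; last by move=> k ks; rewrite mus// in_cons ks orbT.
  congr (_ + _); rewrite RintegralZl//; last first.
    by apply: integrable_indic1; rewrite mus// mem_head.
  by rewrite /Rintegral integral_indic// setIT.
- by apply: integrable_scale_indic1; rewrite mus// mem_head.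
- rewrite (_ : _ \o _ = fun x => (\sum_(k <- s | k \in s) (f k * \1_[set k] x)%:E)%E).
    apply: integrable_sum => // k ks; apply: integrable_scale_indic1.
    by rewrite mus// in_cons ks orbT.
  by apply/funext => x; rewrite /= -sumEFin -big_seq.
Qed.

End finitely_supported.

(** * Empirical means and the effect of moving one particle *)

Section configuration_sums.
Context {R : realType} {d : measure_display} {F : measurableType d}.
Hypothesis F_discrete : forall A : set F, measurable A.

Lemma counting1 (k : F) : counting [set k] = 1%E :> \bar R.
Proof. by rewrite /counting asboolT// fset_set1 cardfs1. Qed.

Lemma counting1_lty (k : F) : (counting [set k] < +oo :> \bar R)%E.
Proof. by rewrite counting1 ltry. Qed.

Section fixed_size.
Variable N : nat.
Implicit Types eta : config F N.

(** The integral [m(eta)(f)] as a finite sum, so that its linearity holds for every [f] without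
    integrability conditions. *)
Definition config_mean eta (f : F -> R) : R :=
  N%:R^-1 * \sum_(k <- finsupp eta) (eta k)%:R * f k.

Lemma config_out eta k : k \notin (finsupp eta : seq F) -> eta k = 0%N.
Proof. by move=> kN; apply: fsfun_dflt. Qed.

Lemma empirical1 eta k : empirical eta [set k] = (N%:R^-1 * (eta k)%:R : R)%:E.
Proof.
rewrite /empirical EFinM; congr (_ * _)%E.
have E i : (\d_i [set k] : \bar R)%E = (i == k)%:R%:E.
  by rewrite diracE; case: eqP => [->|ik]; [rewrite mem_set|rewrite memNset].
under eq_bigr do rewrite E -EFinM.
rewrite sumEFin; congr EFin; have [ks|ks] := boolP (k \in (finsupp eta : seq F)).
  rewrite (bigD1_seq k) ?fset_uniq//= eqxx mulr1 big1 ?addr0// => i /negbTE ->.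
  by rewrite mulr0.
rewrite config_out// big_seq big1// => i iS; case: eqP => ik; last by rewrite mulr0.
by rewrite -ik iS in ks.
Qed.

Lemma empirical1_lty eta k : (empirical eta [set k] < +oo :> \bar R)%E.
Proof. by rewrite empirical1 ltry. Qed.

Lemma Rintegral_empirical eta (f : F -> R) :
  (\int[empirical eta]_k f k)%R = config_mean eta f.
Proof.
pose s : seq F := finsupp eta.
(* [f] may have infinite support, but it agrees with [g] almost everywhere for the empirical
   measure. *)
pose g k := if k \in s then f k else 0.
have -> : (\int[empirical eta]_k f k)%R = (\int[empirical eta]_k g k)%R.
  rewrite /Rintegral; congr fine; apply: ae_eq_integral => //;
    try by move=> _ ? _; exact: F_discrete.
  exists [set k | k \notin s]; split => //; last first.
    move=> k /=; apply: contra_notN => ks _; rewrite /g ks//.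
  rewrite /= /empirical big_seq big1 ?mule0// => i iS.
  by rewrite diracE memNset ?mule0//= /s iS.
rewrite (Rintegral_finite_support F_discrete (s := s)).
- rewrite /config_mean mulr_sumr big_seq [RHS]big_seq; apply: eq_bigr => k ks.
  have -> : fine (empirical eta [set k]) = N%:R^-1 * (eta k)%:R :> R.
    exact: (congr1 fine (empirical1 eta k)).
  by rewrite /g ks; ring.
- exact: fset_uniq.
- by move=> k _; exact: empirical1_lty.
- by move=> k ks; rewrite /g (negbTE ks).
Qed.

Lemma Rintegral_counting_occ eta (f : F -> R) :
  (\int[counting]_(k in [set: F]) ((eta k)%:R * f k))%R =
    \sum_(k <- finsupp eta) (eta k)%:R * f k.
Proof.
rewrite (Rintegral_finite_support F_discrete (s := finsupp eta)).
- by apply: eq_bigr => k _; rewrite (congr1 fine (counting1 k)) mulr1.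
- exact: fset_uniq.
- by move=> k _; apply: counting1_lty.
- by move=> k ks; rewrite config_out// mul0r.
Qed.

Lemma integrable_counting_occ eta (f : F -> R) :
  (counting : {measure set F -> \bar R}).-integrable [set: F]
     (fun k => ((eta k)%:R * f k)%:E).
Proof.
apply: (integrable_finite_support F_discrete (s := finsupp eta)).
- exact: fset_uniq.
- by move=> k _; apply: counting1_lty.
- by move=> k ks; rewrite config_out// mul0r.
Qed.

Lemma config_sum_occ eta : \sum_(k <- finsupp eta) (eta k)%:R = N%:R :> R.
Proof. by rewrite -natr_sum; case: eta => o /= /eqP ->. Qed.

Lemma move_id i eta : eta i != 0%N -> move i i eta = eta.
Proof.
move=> ei; apply/val_inj/fsfunP => k /=; rewrite moveE//.
by case: eqP => [->|_]; rewrite ?subn0// subnKC// lt0n.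
Qed.

Lemma config_sum_incl eta (D : {fset F}) (f : F -> R) :
  {subset (finsupp eta : seq F) <= (D : seq F)} ->
  \sum_(k <- finsupp eta) (eta k)%:R * f k = \sum_(k <- D) (eta k)%:R * f k.
Proof.
move=> sub; apply: big_fset_incl; first exact/fsubsetP.
by move=> k _ ks; rewrite config_out// mul0r.
Qed.

Lemma config_sum_move i j eta (f : F -> R) : eta i != 0%N ->
  \sum_(k <- finsupp (move i j eta)) (move i j eta k)%:R * f k =
  \sum_(k <- finsupp eta) (eta k)%:R * f k + (f j - f i).
Proof.
(* A common index set lets the sums be compared termwise; it contains [i] and [j], so that [f i] and
   [f j] are sums over it too. *)
move=> ei; pose D := (finsupp eta `|` finsupp (move i j eta) `|` [fset i; j])%fset.
rewrite (@config_sum_incl eta D); last by move=> k; rewrite !inE => ->.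
rewrite (@config_sum_incl (move i j eta) D); last by move=> k; rewrite !inE => ->; rewrite orbT.
have single a : a \in (D : seq F) -> \sum_(k <- D) (k == a)%:R * f k = f a.
  move=> aD; rewrite (bigD1_seq a) ?fset_uniq//= eqxx mul1r big1 ?addr0// => k /negbTE ->.
  by rewrite mul0r.
rewrite -(single j) ?inE ?eqxx ?orbT// -(single i) ?inE ?eqxx ?orbT//.
rewrite -sumrB -big_split/=; apply: eq_bigr => k _.
(* The truncated subtraction in [moveE] is exact because [eta i] is at least 1. *)
rewrite moveE// natrD natrB; first by ring.
by case: eqP => [->|//]; rewrite lt0n.
Qed.

Lemma config_mean_move i j eta (f : F -> R) : eta i != 0%N ->
  config_mean (move i j eta) f = config_mean eta f + (f j - f i) / N%:R.
Proof. by move=> ei; rewrite /config_mean config_sum_move// mulrDr [_^-1 * (_ - _)]mulrC. Qed.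

Lemma normr_config_sum_le eta (f : F -> R) (c : R) : (forall k, `|f k| <= c) ->
  `|\sum_(k <- finsupp eta) (eta k)%:R * f k| <= N%:R * c.
Proof.
move=> fc; rewrite (le_trans (ler_norm_sum _ _ _))//.
rewrite -(config_sum_occ eta) mulr_suml; apply: ler_sum => k _.
by rewrite normrM ger0_norm// ler_wpM2l.
Qed.

Lemma normr_config_mean_le eta (f : F -> R) (c : R) : (0 < N)%N ->
  (forall k, `|f k| <= c) -> `|config_mean eta f| <= c.
Proof.
move=> N0 fc; rewrite /config_mean normrM ger0_norm ?invr_ge0//.
by rewrite mulrC ler_pdivrMr ?ltr0n// mulrC normr_config_sum_le.
Qed.

Lemma config_meanD eta (f g : F -> R) :
  config_mean eta (fun k => f k + g k) = config_mean eta f + config_mean eta g.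
Proof.
rewrite /config_mean -[RHS]mulrDr -big_split/=; congr (_ * _).
by apply: eq_bigr => k _; rewrite mulrDr.
Qed.

Lemma config_meanZ eta (c : R) (f : F -> R) :
  config_mean eta (fun k => c * f k) = c * config_mean eta f.
Proof.
rewrite /config_mean [RHS]mulrCA; congr (_ * _); rewrite mulr_sumr.
by apply: eq_bigr => k _; rewrite mulrCA.
Qed.

Lemma config_mean_cst eta (c : R) : (0 < N)%N -> config_mean eta (fun=> c) = c.
Proof.
move=> N0; rewrite /config_mean -mulr_suml config_sum_occ mulKf// pnatr_eq0.
by rewrite -lt0n.
Qed.

Lemma le_config_mean eta (f g : F -> R) : (forall k, f k <= g k) ->
  config_mean eta f <= config_mean eta g.
Proof.
by move=> fg; rewrite ler_wpM2l ?invr_ge0//; apply: ler_sum => k _; rewrite ler_wpM2l.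
Qed.

End fixed_size.

End configuration_sums.

(** * The Fleming-Viot generator applied to a squared empirical mean *)

Section fleming_viot_drift.
Context {R : realType} {d : measure_display} {F : measurableType d}.
Hypothesis F_discrete : forall A : set F, measurable A.
Variables (Q : F -> F -> R) (p0 : F -> R) (q p : R).
Hypothesis Q_ge0 : forall i j, i != j -> 0 <= Q i j.
Hypothesis exit_rate_le : forall i, (exit_rate Q i <= q%:E)%E.
Hypothesis p0_ge0 : forall i, 0 <= p0 i.
Hypothesis p0_le : forall i, p0 i <= p.

Let q_ge0 (i : F) : 0 <= q.
Proof.
rewrite -lee_fin; apply: le_trans (exit_rate_le i); apply: integral_ge0 => j /=.
by rewrite eq_sym => ij; rewrite lee_fin Q_ge0.
Qed.

(** The hypotheses of the section do not control the diagonal entry. Increments vanish at [i], so it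
    may be set to 0, which makes row [i] nonnegative with integral [exit_rate Q i]. *)
Let off_diag i j : R := if j == i then 0 else Q i j.

Let off_diag_ge0 i j : 0 <= off_diag i j.
Proof. by rewrite /off_diag; case: eqVneq => // ji; rewrite Q_ge0// eq_sym. Qed.

Let integral_off_diag i :
  (\int[counting]_j (off_diag i j)%:E = exit_rate Q i)%E.
Proof.
rewrite /exit_rate [RHS]integral_mkcond; apply: eq_integral => j _.
rewrite /patch /off_diag; case: eqVneq => ji.
  by rewrite memNset//= ji eqxx.
by rewrite mem_set.
Qed.

Let off_diag_integrable i :
  (counting : {measure set F -> \bar R}).-integrable [set: F] (EFin \o off_diag i).
Proof.
apply/integrableP; split; first by move=> _ ? _; exact: F_discrete.
under eq_integral do rewrite gee0_abs ?lee_fin//.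
by rewrite integral_off_diag (le_lt_trans (exit_rate_le i))// ltry.
Qed.

Let rateM i (h : F -> R) j : h i = 0 -> Q i j * h j = off_diag i j * h j.
Proof. by rewrite /off_diag => hi; case: eqVneq => [->|//]; rewrite hi !mulr0. Qed.

Lemma integrable_rateM i (h : F -> R) (c : R) : (forall j, `|h j| <= c) -> h i = 0 ->
  (counting : {measure set F -> \bar R}).-integrable [set: F]
     (fun j => (Q i j * h j)%:E).
Proof.
move=> hc hi.
apply: (le_integrable _ _ _ (integrableZl measurableT c (off_diag_integrable i))) => //.
move=> j _; suff : `|Q i j * h j| <= `|c * off_diag i j| by rewrite -lee_fin.
rewrite rateM// normrM mulrC normrM ler_wpM2r//.
exact: le_trans (ler_norm _).
Qed.

Lemma normr_Rintegral_rateM i (h : F -> R) (c : R) : (forall j, `|h j| <= c) -> h i = 0 ->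
  `|(\int[counting]_j (Q i j * h j))%R| <= c * q.
Proof.
move=> hc hi; have c0 : 0 <= c by exact: le_trans (hc i).
apply: (le_trans (le_normr_Rintegral measurableT _)); first exact: integrable_rateM hc hi.
apply: (@le_trans _ _ (\int[counting]_j (c * off_diag i j))%R).
  apply: le_Rintegral => //.
  - have := integrable_rateM hc hi => /integrable_abse.
    by apply: eq_integrable.
  - exact: (integrableZl measurableT c (off_diag_integrable i)).
  - by move=> j _; rewrite rateM// normrM mulrC (ger0_norm (off_diag_ge0 _ _)) ler_wpM2r.
rewrite RintegralZl// ler_wpM2l// /Rintegral integral_off_diag -lee_fin fineK//.
rewrite ge0_fin_numE ?(le_lt_trans (exit_rate_le i)) ?ltry//.
by rewrite -integral_off_diag integral_ge0// => j _; rewrite lee_fin.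
Qed.

Section particle_drift.
Variables (N : nat) (eta : config F N).
Hypothesis N_ge2 : (2 <= N)%N.

(** The contribution of one particle sitting at [i], with [h j] the increment caused by its jump to
    [j]. The condition [h i = 0] met below reflects that a jump from [i] to itself changes
    nothing. *)
Definition particle_drift i (h : F -> R) : R :=
  (\int[counting]_(j in [set: F]) (h j * (Q i j + p0 i * (eta j)%:R / N.-1%:R)))%R.

Lemma particle_driftE i (h : F -> R) (c : R) : (forall j, `|h j| <= c) -> h i = 0 ->
  particle_drift i h = (\int[counting]_j (Q i j * h j))%R +
    p0 i / N.-1%:R * \sum_(j <- finsupp eta) (eta j)%:R * h j.
Proof.
move=> hc hi; rewrite /particle_drift.
have -> : (\int[counting]_(j in [set: F]) (h j * (Q i j + p0 i * (eta j)%:R / N.-1%:R)))%R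
  = (\int[counting]_j (Q i j * h j + (eta j)%:R * (p0 i / N.-1%:R * h j)))%R.
  by apply: eq_Rintegral => j _; ring.
rewrite RintegralD//.
- rewrite Rintegral_counting_occ// mulr_sumr; congr (_ + _).
  by apply: eq_bigr => j _; ring.
- exact: integrable_rateM hc hi.
- exact: integrable_counting_occ.
Qed.

Lemma particle_driftD i (g h : F -> R) (a b : R) :
  (forall j, `|g j| <= a) -> (forall j, `|h j| <= b) -> g i = 0 -> h i = 0 ->
  particle_drift i (fun j => g j + h j) = particle_drift i g + particle_drift i h.
Proof.
move=> ga hb gi hi; rewrite (@particle_driftE _ _ (a + b)); first last.
- by rewrite gi hi addr0.
- by move=> j; rewrite (le_trans (ler_normD _ _))// lerD.
rewrite (particle_driftE ga gi) (particle_driftE hb hi).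
have -> : (\int[counting]_j (Q i j * (g j + h j)))%R =
          (\int[counting]_j (Q i j * g j))%R + (\int[counting]_j (Q i j * h j))%R.
  rewrite -RintegralD//; [|exact: integrable_rateM ga gi|exact: integrable_rateM hb hi].
  by apply: eq_Rintegral => j _; ring.
have -> : \sum_(j <- finsupp eta) (eta j)%:R * (g j + h j) =
    \sum_(j <- finsupp eta) (eta j)%:R * g j + \sum_(j <- finsupp eta) (eta j)%:R * h j.
  by rewrite -big_split; apply: eq_bigr => j _; rewrite mulrDr.
by ring.
Qed.

Lemma particle_driftZ i (k : R) (h : F -> R) (c : R) :
  (forall j, `|h j| <= c) -> h i = 0 ->
  particle_drift i (fun j => k * h j) = k * particle_drift i h.
Proof.
move=> hc hi; rewrite (@particle_driftE _ _ (`|k| * c)); first last.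
- by rewrite hi mulr0.
- by move=> j; rewrite normrM ler_wpM2l.
rewrite (particle_driftE hc hi).
have -> : (\int[counting]_j (Q i j * (k * h j)))%R = k * (\int[counting]_j (Q i j * h j))%R.
  rewrite -RintegralZl//; last exact: integrable_rateM hc hi.
  by apply: eq_Rintegral => j _; ring.
have -> : \sum_(j <- finsupp eta) (eta j)%:R * (k * h j) =
    k * \sum_(j <- finsupp eta) (eta j)%:R * h j.
  by rewrite mulr_sumr; apply: eq_bigr => j _; ring.
by ring.
Qed.

Let N1_gt0 : 0 < N.-1%:R :> R.
Proof. by rewrite ltr0n; case: N N_ge2 => [|[]]. Qed.

Let N_gt0 : 0 < N%:R :> R.
Proof. by rewrite ltr0n (leq_trans _ N_ge2). Qed.

Let N_le : N%:R <= 2 * N.-1%:R :> R.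
Proof. by rewrite -natrM ler_nat; case: N N_ge2 => [|[|n]]//= _; rewrite mulSn mul1n addnS addSn !ltnS leq_addl. Qed.

(** The rebirth rates from [i] add up to [p0 i * N / (N - 1)], since the occupation numbers include
    the particle itself; [N >= 2] bounds this by [2 * p]. *)
Lemma normr_particle_drift_le i (h : F -> R) (c : R) :
  (forall j, `|h j| <= c) -> h i = 0 ->
  `|particle_drift i h| <= c * (q + 2 * p).
Proof.
move=> hc hi; have c0 : 0 <= c by exact: le_trans (hc i).
rewrite (particle_driftE hc hi) (le_trans (ler_normD _ _))// mulrDr.
rewrite lerD ?normr_Rintegral_rateM// normrM ger0_norm ?divr_ge0 ?p0_ge0//.
apply: (@le_trans _ _ (p0 i / N.-1%:R * (N%:R * c))).
  by rewrite ler_wpM2l ?divr_ge0 ?p0_ge0// normr_config_sum_le.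
apply: (@le_trans _ _ (p0 i / N.-1%:R * (2 * N.-1%:R * c))).
  by rewrite ler_wpM2l ?divr_ge0 ?p0_ge0// ler_wpM2r.
rewrite (_ : _ * _ = c * (2 * p0 i)); first by rewrite !ler_wpM2l.
by field; rewrite gt_eqF.
Qed.

Lemma particle_drift_increment i (f : F -> R) (c : R) : (forall j, `|f j| <= c) ->
  particle_drift i (fun j => f j - f i) =
    (\int[counting]_j (Q i j * (f j - f i)))%R +
    p0 i * (N%:R / N.-1%:R) * (config_mean eta f - f i).
Proof.
move=> fc; rewrite (@particle_driftE _ _ (2 * c)); first last.
- by rewrite subrr.
- by move=> j; rewrite (le_trans (ler_normB _ _))// mulr_natl mulr2n lerD.
congr (_ + _).
have -> : \sum_(j <- finsupp eta) (eta j)%:R * (f j - f i) =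
    N%:R * (config_mean eta f - f i).
  under eq_bigr do rewrite mulrBr.
  rewrite sumrB -mulr_suml config_sum_occ mulrBr /config_mean mulrA mulfV ?mul1r//.
  by rewrite gt_eqF.
by field; rewrite gt_eqF.
Qed.

Lemma fv_generatorE (f : config F N -> R) : fv_generator Q p0 f eta =
  \sum_(i <- finsupp eta) (eta i)%:R *
    particle_drift i (fun j => f (move i j eta) - f eta).
Proof. by rewrite /fv_generator Rintegral_counting_occ. Qed.

Lemma occ_neq0 i : i \in (finsupp eta : seq F) -> eta i != 0%N.
Proof. by rewrite mem_finsupp. Qed.

Lemma normr_fv_generator_le (f : config F N -> R) (c : R) :
  (forall i j, `|f (move i j eta) - f eta| <= c) ->
  `|fv_generator Q p0 f eta| <= N%:R * (c * (q + 2 * p)).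
Proof.
move=> fc; rewrite fv_generatorE (le_trans (ler_norm_sum _ _ _))//.
rewrite -(config_sum_occ (R := R) eta) mulr_suml big_seq [leRHS]big_seq.
apply: ler_sum => i /occ_neq0 ei; rewrite normrM ger0_norm// ler_wpM2l//.
by apply: normr_particle_drift_le => //; rewrite move_id// subrr.
Qed.

(** The interaction contributes the quadratic term [2 p m(f)^2], which only
    costs a factor [exp (2 p t)] in Gronwall's lemma; the discrepancy
    [N / (N - 1) - 1] and the carre du champ are both O(1/N). *)
Lemma fv_generator_sqr_config_mean_le (f : F -> R) (c : R) : (forall j, `|f j| <= c) ->
  fv_generator Q p0 (fun xi => config_mean xi f ^+ 2) eta <=
    2 * config_mean eta f *
      config_mean eta (fun i => (\int[counting]_j (Q i j * (f j - f i)))%R - p0 i * f i) +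
    2 * p * config_mean eta f ^+ 2 + c ^+ 2 * (4 * q + 16 * p) / N%:R.
Proof.
move=> fc; set m := config_mean eta f; set n : R := N%:R.
have n0 : n != 0 by rewrite gt_eqF.
have [i0 _] : exists i : F, True by exists point.
have c0 : 0 <= c by exact: le_trans (fc i0).
have p_ge0 : 0 <= p by exact: le_trans (p0_le i0).
have fi2 i j : `|f j - f i| <= 2 * c.
  by rewrite (le_trans (ler_normB _ _))// mulr_natl mulr2n lerD.
have fi4 i j : `|(f j - f i) ^+ 2| <= (2 * c) ^+ 2.
  by rewrite normrX lerXn2r ?nnegrE ?mulr_ge0//.
(* Expansion of [(m + (f j - f i) / n) ^+ 2 - m ^+ 2]: the linear part is the drift, the quadratic
   part the carre du champ. *)
have E i : eta i != 0%N ->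
   particle_drift i (fun j => config_mean (move i j eta) f ^+ 2 - m ^+ 2) =
   2 * m / n * particle_drift i (fun j => f j - f i) +
   n ^- 2 * particle_drift i (fun j => (f j - f i) ^+ 2).
  move=> ei.
  rewrite -(particle_driftZ _ (fi2 i)) ?subrr// -(particle_driftZ _ (fi4 i)) ?subrr ?expr0n//.
  rewrite -(@particle_driftD _ _ _ (`|2 * m / n| * (2 * c)) (`|n ^- 2| * (2 * c) ^+ 2)).
  - congr particle_drift; apply/funext => j; rewrite config_mean_move// -/m -/n.
    by field.
  - by move=> j; rewrite normrM ler_wpM2l.
  - by move=> j; rewrite normrM ler_wpM2l.
  - by rewrite subrr mulr0.
  - by rewrite subrr expr0n mulr0.
rewrite fv_generatorE big_seq (eq_bigr _ (fun i H => congr1 _ (E i (occ_neq0 H)))) -big_seq.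
have -> : \sum_(i <- finsupp eta) (eta i)%:R *
     (2 * m / n * particle_drift i (fun j => f j - f i) +
     n ^- 2 * particle_drift i (fun j => (f j - f i) ^+ 2)) =
  2 * m * config_mean eta (fun i => particle_drift i (fun j => f j - f i)) +
  n^-1 * config_mean eta (fun i => particle_drift i (fun j => (f j - f i) ^+ 2)).
  rewrite /config_mean !mulr_sumr -big_split/=; apply: eq_bigr => i _.
  by rewrite -/n; field.
have carre : config_mean eta (fun i => particle_drift i (fun j => (f j - f i) ^+ 2)) <=
    (2 * c) ^+ 2 * (q + 2 * p).
  apply: le_trans (ler_norm _) _; apply: normr_config_mean_le.
    by rewrite (leq_trans _ N_ge2).
  by move=> i; apply: normr_particle_drift_le => //; rewrite subrr expr0n.
set gf := fun i => _ - p0 i * f i.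
(* Here [N / (N - 1) = 1 + 1 / (N - 1)]: the 1 supplies the killing term of [gf] and the quadratic
   interaction, the rest is the discrepancy. *)
have -> : config_mean eta (fun i => particle_drift i (fun j => f j - f i)) =
  config_mean eta gf + m * config_mean eta p0 +
    N.-1%:R^-1 * (m * config_mean eta p0 - config_mean eta (fun i => p0 i * f i)).
  rewrite mulrBr -!config_meanZ -mulN1r -!config_meanZ -!config_meanD /config_mean.
  congr (_ * _); apply: eq_bigr => i _; congr (_ * _).
  rewrite (particle_drift_increment i fc) /gf -/m.
  have nE : N%:R = N.-1%:R + 1 :> R by rewrite natr1 prednK// (leq_trans _ N_ge2).
  by rewrite nE; field; rewrite gt_eqF.
have N_pos : (0 < N)%N by rewrite (leq_trans _ N_ge2).
have m_le : `|m| <= c by exact: normr_config_mean_le.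
have mp_le : config_mean eta p0 <= p.
  by rewrite -[leRHS](config_mean_cst eta p N_pos) le_config_mean.
have mp_norm : `|config_mean eta p0| <= p.
  by apply: normr_config_mean_le => // k; rewrite ger0_norm.
have mpf : `|config_mean eta (fun i => p0 i * f i)| <= p * c.
  by apply: normr_config_mean_le => // k; rewrite normrM ler_pM// ger0_norm.
have N1i : N.-1%:R^-1 <= 2 / n.
  by rewrite ler_pdivlMr// mulrC ler_pdivrMr.
have discr : m * (N.-1%:R^-1 * (m * config_mean eta p0 - config_mean eta (fun i => p0 i * f i)))
    <= 4 * p * c ^+ 2 / n.
  apply: le_trans (ler_norm _) _.
  rewrite (normrM m) (normrM N.-1%:R^-1).
  apply: (@le_trans _ _ (c * (2 / n * (c * p + p * c)))).
    apply: ler_pM => //.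
    apply: ler_pM => //; last first.
      by rewrite (le_trans (ler_normB _ _))// lerD// normrM ler_pM.
    by rewrite (ger0_norm (_ : 0 <= N.-1%:R^-1))// invr_ge0 ltW.
  by rewrite le_eqVlt; apply/orP; left; apply/eqP; field.
(* The carre du champ accounts for [4 * q + 8 * p], the discrepancy for the other [8 * p]. *)
rewrite (_ : c ^+ 2 * _ / n = 2 * (4 * p * c ^+ 2 / n) +
   n^-1 * ((2 * c) ^+ 2 * (q + 2 * p))); last by field.
have : n^-1 * config_mean eta (fun i => particle_drift i (fun j => (f j - f i) ^+ 2))
   <= n^-1 * ((2 * c) ^+ 2 * (q + 2 * p)) by rewrite ler_wpM2l ?invr_ge0// ltW.
have : m ^+ 2 * config_mean eta p0 <= m ^+ 2 * p by rewrite ler_wpM2l ?sqr_ge0.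
lra.
Qed.

End particle_drift.

End fleming_viot_drift.

(** * Countability of the configurations and the law at a fixed time *)

Section law_of_jump_process.
Context {R : realType}.

(** A configuration is encoded by the list of pairs (number of the site, occupation) over its
    support. Summing the occupations attached to the number of [k] recovers [eta k], whatever the
    order of the list. *)
Lemma countable_config (F : choiceType) N : countable [set: F] ->
  countable [set: config F N].
Proof.
move/countable_injP => [g ginj]; apply/countable_injP.
have {}ginj : injective g by move=> x y; apply: ginj; rewrite inE.
pose code (eta : config F N) : seq (nat * nat) := [seq (g k, eta k) | k <- finsupp eta].
exists (fun eta => choice.pickle (code eta)) => e1 e2 _ _ /(pcan_inj (@choice.pickleK _)) e12.
have decode (eta : config F N) k :
    sumn [seq x.2 | x <- code eta & x.1 == g k] = eta k.
  rewrite /code filter_map -map_comp sumnE big_map big_filter/=.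
  have [ks|ks] := boolP (k \in (finsupp eta : seq F)).
    rewrite big_mkcond (bigD1_seq k) ?fset_uniq//= eqxx big1 ?addn0// => i ik.
    by rewrite (inj_eq ginj) (negbTE ik).
  rewrite fsfun_dflt// big_seq_cond big1// => i /andP[iS /eqP/ginj ik].
  by rewrite -ik iS in ks.
by apply/val_inj/fsfunP => k; rewrite -!decode e12.
Qed.

Lemma eq_measure_countable {d} {T : measurableType d} (m1 m2 : {measure set T -> \bar R}) :
  countable [set: T] -> (forall A : set T, measurable A) ->
  (forall x, m1 [set x] = m2 [set x]) -> forall A, m1 A = m2 A.
Proof.
move=> /countable_injP[g ginj] Tm m12 A.
pose B n := A `&` g @^-1` [set n].
have AE : A = \bigcup_n B n.
  apply/seteqP; split => [x Ax|x [n _ []]//]; exists (g x) => //; split.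
have tB : trivIset setT B.
  by apply/trivIsetP => i j _ _ ij; apply/seteqP; split => // x [[_ /= gi] [_ /= gj]];
    rewrite -gi -gj eqxx in ij.
rewrite AE !measure_bigcup//; apply: eq_eseriesr => n _.
have [[x [Ax gx]]|Bn0] := pselect (B n !=set0).
  suff -> : B n = [set x] by [].
  apply/seteqP; split => [y [Ay gy]|y ->//].
  by apply: ginj; rewrite ?inE//= gx gy.
by rewrite (_ : B n = set0) ?measure0//; apply/seteqP; split => // x Bx; case: Bn0; exists x.
Qed.

Lemma expectation_jump_process {d} {S : measurableType d} (P : R -> R.-pker S ~> S)
    {d'} {Omega : measurableType d'} (Pr : probability Omega R)
    (X : R -> {mfun Omega >-> S}) (x : S) (t : R) (f : S -> R) (c : R) :
  countable [set: S] -> (forall A : set S, measurable A) ->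
  markov_jump_process P Pr X -> started_at Pr X x -> 0 <= t ->
  (forall y, 0 <= f y <= c) ->
  ('E_Pr[fun w => f (X t w)] = (sg_apply P t f x)%:E)%E.
Proof.
move=> cS mS PX X0 t0 fc.
have fb y : `|f y| <= c by have /andP[? ?] := fc y; rewrite ger0_norm.
have law y : Pr (X t @^-1` [set y]) = P t x [set y].
  (* The Markov property at [s = 0] with an empty past: the times and states supplied are dummies
     indexed by ['I_0]. The event [X 0 = x] has full probability and is then removed. *)
  have := @mjp_markov _ _ _ _ _ _ _ _ PX 0 (fun=> 0) (fun=> point) 0 t x y.
  rewrite lexx t0 => /(_ (fun k => ltac:(by case: k)) isT) /=.
  rewrite (_ : [set w | forall k : 'I_0, X 0 w = point] = setT); last first.
    by apply/seteqP; split => // w _ [].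
  rewrite setTI subr0 X0 mul1e => <-.
  have m0 : measurable [set w | X 0 w = x].
    rewrite (_ : [set w | _] = X 0 @^-1` [set x])//.
    by rewrite -[X in measurable X]setTI; exact: measurable_funP.
  have mt : measurable [set w | X t w = y].
    rewrite (_ : [set w | _] = X t @^-1` [set y])//.
    by rewrite -[X in measurable X]setTI; exact: measurable_funP.
  have C0 : Pr (~` [set w | X 0 w = x]) = 0%E.
    by rewrite probability_setC// X0 subee.
  rewrite setIC (measureDI Pr mt m0) [X in (X + _)%E](_ : _ = 0%E) ?add0e//.
  apply/eqP; rewrite eq_le measure_ge0 andbT -[leRHS]C0 le_measure ?inE//.
  - exact: measurableD.
  - exact: measurableC.
rewrite unlock /expectation.
transitivity (\int[pushforward Pr (X t)]_y (f y)%:E)%E.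
  rewrite ge0_integral_pushforward//.
  by move=> y; rewrite lee_fin; case/andP: (fc y).
rewrite /sg_apply /Rintegral fineK; last first.
  apply: integrable_fin_num => //.
  exact: (discrete_integrable mS (sg_mass1 P t x) fb).
apply: eq_measure_integral => A _ _.
exact: eq_measure_countable.
Qed.

End law_of_jump_process.

(** * Total variation distance as a real bound on differences of integrals *)

Section total_variation.
Context {R : realType} {d : measure_display} {S : measurableType d}.
Hypothesis S_discrete : forall A : set S, measurable A.
Variables mu nu : {measure set S -> \bar R}.
Hypotheses (mu1 : mu [set: S] = 1%E) (nu1 : nu [set: S] = 1%E).

Lemma dTV_fin_num_ge0 : exists2 D : R, 0 <= D & dTV mu nu = D%:E.
Proof.
set A := [set ((\int[mu]_x f x)%R - (\int[nu]_x f x)%R)%:E | f in @bounded_by1 R S].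
have ub : (ereal_sup A <= 2%:E)%E.
  apply: ge_ereal_sup => _ [f f1 <-]; rewrite lee_fin.
  apply: le_trans (ler_norm _) _; apply: le_trans (ler_normB _ _) _.
  by rewrite (_ : 2 = 1 + 1)// lerD//; exact: normr_Rintegral_le.
have lb : (0%:E <= ereal_sup A)%E.
  apply: ereal_sup_ubound; exists (cst 0); first by move=> x; rewrite normr0.
  by rewrite !Rintegral_mass1_cst// subrr.
have fA : ereal_sup A \is a fin_num.
  by rewrite ge0_fin_numE// (le_lt_trans ub)// ltry.
exists (2^-1 * fine (ereal_sup A)); first by rewrite mulr_ge0// fine_ge0.
by rewrite /dTV -/A EFinM fineK.
Qed.

(** [f / c] and its opposite are admissible in the supremum; the 2 undoes the factor 1/2 in
    [dTV]. *)
Lemma normr_RintegralB_le_dTV (f : S -> R) (c D : R) : 0 < c ->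
  (forall x, `|f x| <= c) -> dTV mu nu = D%:E ->
  `|(\int[mu]_x f x)%R - (\int[nu]_x f x)%R| <= 2 * c * D.
Proof.
move=> c0 fc; rewrite /dTV; set A := [set _ | f in _] => DE.
have AE : ereal_sup A = (2 * D)%:E.
  by rewrite EFinM -DE muleA -EFinM divff// mul1e.
have one (o : R) : `|o| = 1 ->
    o * ((\int[mu]_x f x)%R - (\int[nu]_x f x)%R) <= 2 * c * D.
  move=> o1; have Z (m : {measure set S -> \bar R}) : m [set: S] = 1%E ->
      (\int[m]_x (o / c * f x))%R = o / c * (\int[m]_x f x)%R.
    by move=> m1; rewrite RintegralZl//; exact: (discrete_integrable S_discrete m1 fc).
  have : ((o / c * ((\int[mu]_x f x)%R - (\int[nu]_x f x)%R))%:E <= ereal_sup A)%E.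
    apply: ereal_sup_ubound; exists (fun x => o / c * f x).
      move=> x; rewrite /= normrM normrM o1 mul1r gtr0_norm ?invr_gt0//.
      by rewrite mulrC ler_pdivrMr// mul1r.
    by rewrite !Z// mulrBr.
  rewrite AE lee_fin (_ : o / c * _ =
    o * ((\int[mu]_x f x)%R - (\int[nu]_x f x)%R) / c); last by ring.
  by rewrite ler_pdivrMr// mulrAC.
have := one 1 (normr1 _); have := one (-1) (normrN1 _).
by rewrite ler_norml; lra.
Qed.

End total_variation.

(** * The absorbed semigroup and centring by the conditioned law *)

Section absorbed_process.
Context {R : realType} {d : measure_display} {F : measurableType d}.
Hypothesis F_discrete : forall A : set F, measurable A.
Variables (Q : F -> F -> R) (p0 : F -> R) (q p : R).
Hypothesis Q_ge0 : forall i j, i != j -> 0 <= Q i j.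
Hypothesis exit_rate_le : forall i, (exit_rate Q i <= q%:E)%E.
Hypothesis p0_ge0 : forall i, 0 <= p0 i.
Hypothesis p0_le : forall i, p0 i <= p.
Hypothesis q_ge0 : 0 <= q.
Hypothesis p_ge0 : 0 <= p.
Variable P : R -> R.-pker (with_cemetery F) ~> (with_cemetery F).
Hypothesis P_sg : markov_semigroup (absorbed_generator Q p0) P.

Lemma cemetery_discrete (A : set (with_cemetery F)) : measurable A.
Proof. exact: F_discrete. Qed.

Lemma absorbed_generator_exit_le x :
  - absorbed_generator Q p0 \1_[set x] x <= q + p.
Proof.
case: x => [i|] /=; last by rewrite oppr0 addr_ge0.
set h := fun j : F => (\1_[set Some i] (Some j) - \1_[set Some i] (Some i) : R).
have ii : \1_[set Some i] (Some i : with_cemetery F) = 1 :> R by rewrite indicE mem_set.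
have iN : \1_[set Some i] (None : with_cemetery F) = 0 :> R by rewrite indicE memNset.
have h1 j : `|h j| <= 1.
  rewrite /h ii indicE; case: (_ \in _); first by rewrite subrr normr0.
  by rewrite sub0r normrN1.
have hi : h i = 0 by rewrite /h subrr.
have := normr_Rintegral_rateM F_discrete Q_ge0 exit_rate_le h1 hi.
rewrite ler_norml mul1r => /andP[lb _].
rewrite -/h ii iN sub0r mulrN1.
have := p0_le i.
have -> : (\int[counting]_(j in [set: F]) (Q i j * (\1_[set Some i] (Some j : with_cemetery F) - 1)))%R
  = (\int[counting]_j (Q i j * h j))%R by apply: eq_Rintegral => j _; rewrite /h ii.
lra.
Qed.

(** The generator vanishes at the cemetery, so the exit estimate applies there with rate 0. *)
Lemma sg_apply_cemetery r (f : with_cemetery F -> R) (c : R) : 0 <= r ->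
  (forall x, `|f x| <= c) -> sg_apply P r f None = f None.
Proof.
move=> r0 fc.
have := normr_sg_applyB_le cemetery_discrete P_sg (x := None) (lexx 0) r0 fc.
rewrite /= oppr0 => /(_ (lexx _)).
by rewrite mulr0 mul0r normr_le0 subr_eq0 => /eqP.
Qed.

Definition alive (x : with_cemetery F) : R := \1_(~` [set None]) x.

Lemma alive_Some i : alive (Some i) = 1.
Proof. by rewrite /alive indicE mem_set. Qed.

Lemma alive_None : alive None = 0.
Proof. by rewrite /alive indicE memNset//= => /(_ erefl). Qed.

Lemma normr_alive x : `|alive x| <= 1.
Proof. exact: normr_indic_le1. Qed.

(** Centred so that [mu (P_t psi) = 0]; no lower bound on the survival
    probability is needed, since [|mu (P_t phi)| <= mu (P_t 1_alive)]. *)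
Lemma conditioned_centred (mu : probability F R) (t : R) (phi : F -> R) :
  bounded_by1 phi -> `|conditioned P mu t phi| <= 1 /\
  (\int[mu]_i sg_apply P t
    (fun x => ext0 phi x - conditioned P mu t phi * alive x) (Some i))%R = 0.
Proof.
move=> phi1; set c := conditioned P mu t phi.
have ephi x : `|ext0 phi x| <= alive x.
  by case: x => [i|]; rewrite ?alive_Some ?alive_None/= ?normr0// phi1.
have ephi1 x : `|ext0 phi x| <= 1.
  by rewrite (le_trans (ephi x))// (le_trans (ler_norm _)) ?normr_alive.
set a := (\int[mu]_y sg_apply P t (ext0 phi) (Some y))%R.
set b := (\int[mu]_y sg_apply P t alive (Some y))%R.
have cE : c = a / b by [].
have mu1 := probability_setT mu.
have Pphi1 y : `|sg_apply P t (ext0 phi) (Some y)| <= 1.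
  exact: (normr_sg_apply_le cemetery_discrete).
have Palive1 y : `|sg_apply P t alive (Some y)| <= 1.
  by apply: (normr_sg_apply_le cemetery_discrete) => x; exact: normr_alive.
have ab : `|a| <= b.
  apply: (le_trans (le_normr_Rintegral measurableT _)).
    exact: (discrete_integrable F_discrete mu1 Pphi1).
  apply: le_Rintegral => //.
  - by apply: (@discrete_integrable _ _ _ F_discrete _ mu1 _ 1) => y; rewrite normr_id.
  - exact: (discrete_integrable F_discrete mu1 Palive1).
  - move=> y _; apply: (le_trans (le_normr_Rintegral measurableT _)).
      exact: (discrete_integrable cemetery_discrete (sg_mass1 P t _) ephi1).
    apply: (@le_sg_apply _ _ _ cemetery_discrete _ _ _ _ 1 1) => //.
      by move=> x; rewrite normr_id.
    exact: normr_alive.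
(* If [b] were 0, then [a = 0] by [ab], and the convention on division by zero would still give the
   identity. *)
have acb : a = c * b.
  rewrite cE; have [b0|b0] := eqVneq b 0; last by rewrite divfK.
  by move: ab; rewrite b0 normr_le0 => /eqP ->; rewrite !mul0r.
have c1 : `|c| <= 1.
  have b_ge0 : 0 <= b by exact: le_trans ab.
  rewrite cE; have [->|b0] := eqVneq b 0; first by rewrite invr0 mulr0 normr0.
  by rewrite normrM normfV (ger0_norm b_ge0) ler_pdivrMr ?mul1r// lt_def b0.
split => //.
have calive x : `|c * alive x| <= 1 by rewrite normrM mulr_ile1// normr_alive.
have E y : sg_apply P t (fun x => ext0 phi x - c * alive x) (Some y) =
   sg_apply P t (ext0 phi) (Some y) - c * sg_apply P t alive (Some y).
  rewrite (sg_applyB cemetery_discrete _ _ _ ephi1 calive).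
  by rewrite (sg_applyZ cemetery_discrete _ _ _ _ normr_alive).
under eq_Rintegral do rewrite E.
rewrite RintegralB//; first last.
- by apply: (@discrete_integrable _ _ _ F_discrete _ mu1 _ 1) => y; rewrite normrM mulr_ile1.
- exact: (discrete_integrable F_discrete mu1 Pphi1).
rewrite RintegralZl//; last exact: (discrete_integrable F_discrete mu1 Palive1).
by rewrite -/a -/b -acb subrr.
Qed.

(** * Second moment of the particle system along the backward semigroup *)

Section second_moment.
Variable N : nat.
Hypothesis N_ge2 : (2 <= N)%N.
Variable PN : R -> R.-pker (config F N) ~> (config F N).
Hypothesis PN_sg : markov_semigroup (fv_generator Q p0) PN.

Lemma config_discrete (A : set (config F N)) : measurable A.
Proof. by []. Qed.

Let N_gt0 : (0 < N)%N. Proof. exact: leq_trans N_ge2. Qed.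

(** A bound on the total jump rate of the N particles. It enters only the coefficient of [h ^+ 2],
    hence not the final estimate. *)
Let qN : R := N%:R * (q + 2 * p).

Lemma fv_generator_exit_le (eta : config F N) :
  - fv_generator Q p0 \1_[set eta] eta <= qN.
Proof.
apply: le_trans (ler_norm _) _; rewrite normrN /qN.
rewrite -[q + _]mul1r.
apply: (normr_fv_generator_le F_discrete Q_ge0 exit_rate_le p0_ge0 p0_le) => // i j.
have eta1 : \1_[set eta] eta = 1 :> R by rewrite indicE mem_set.
rewrite eta1 indicE.
by case: (_ \in _); rewrite ?subrr ?normr0// sub0r normrN1.
Qed.

Variables (psi : with_cemetery F -> R) (c : R).
Hypothesis psi_le : forall x, `|psi x| <= c.
Hypothesis psi_None : psi None = 0.

Let g r (i : F) : R := sg_apply P r psi (Some i).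

Let g_le r i : `|g r i| <= c.
Proof. exact: (normr_sg_apply_le cemetery_discrete). Qed.

Let c_ge0 : 0 <= c. Proof. exact: le_trans (psi_le None). Qed.

Let m r xi : R := @config_mean R d F N xi (g r).

Let m_le r xi : `|m r xi| <= c.
Proof. exact: normr_config_mean_le. Qed.

(** The absorbed generator applied to [P_r psi], whose value at the cemetery is 0. *)
Let gen r i : R := (\int[counting]_j (Q i j * (g r j - g r i)))%R - p0 i * g r i.

Let m_increment (r h : R) xi : 0 <= r -> 0 <= h ->
  `|m (r + h) xi - m r xi - h * config_mean xi (gen r)| <= 4 * c * (q + p) ^+ 2 * h ^+ 2.
Proof.
move=> r0 h0.
have -> : m (r + h) xi - m r xi - h * config_mean xi (gen r) =
   config_mean xi (fun i => g (r + h) i - g r i - h * gen r i).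
  rewrite /m -(mulNr h) -[- config_mean _ (g r)]mulN1r -!config_meanZ -!config_meanD.
  by congr config_mean; apply/funext => i; ring.
apply: normr_config_mean_le => // i.
have H := normr_sg_expansion_le cemetery_discrete P_sg (Some i) (addr_ge0 q_ge0 p_ge0) h0
  (fun x => normr_sg_apply_le cemetery_discrete P r x psi_le) absorbed_generator_exit_le.
have E : sg_apply P (r + h) psi (Some i) = sg_apply P h (sg_apply P r psi) (Some i).
  by rewrite addrC (sg_apply_comp cemetery_discrete P_sg _ h0 r0 psi_le).
apply: le_trans H; rewrite /= (sg_apply_cemetery r0 psi_le) psi_None sub0r.
rewrite /gen /g E le_eqVlt; apply/orP; left; apply/eqP; congr `|_ - _ - h * _|.
by rewrite mulrN addrC.
Qed.

Let m_lipschitz (r h : R) xi : 0 <= r -> 0 <= h ->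
  `|m (r + h) xi - m r xi| <= 2 * c * (q + p) * h.
Proof.
move=> r0 h0.
have -> : m (r + h) xi - m r xi = config_mean xi (fun i => g (r + h) i - g r i).
  rewrite /m -[- config_mean _ (g r)]mulN1r -!config_meanZ -!config_meanD.
  by congr config_mean; apply/funext => i; ring.
apply: normr_config_mean_le => // i.
rewrite /g (addrC r h) (sg_apply_comp cemetery_discrete P_sg _ h0 r0 psi_le).
apply: (normr_sg_applyB_le cemetery_discrete P_sg (addr_ge0 q_ge0 p_ge0) h0).
- exact: (fun x => normr_sg_apply_le cemetery_discrete P r x psi_le).
- exact: absorbed_generator_exit_le.
Qed.

Let K : R := c ^+ 2 * (4 * q + 16 * p) / N%:R.

Let msqr_le r xi : `|m r xi ^+ 2| <= c ^+ 2.
Proof. by rewrite normrX lerXn2r ?nnegrE. Qed.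

(** The three terms come from expanding the particle semigroup, from expanding the absorbed one, and
    from replacing [m r xi ^+ 2] by [m (r + h) xi ^+ 2] in the interaction term. *)
Let remainder : R := 4 * c ^+ 2 * qN ^+ 2 + 8 * c ^+ 2 * (q + p) ^+ 2 +
  8 * p * c ^+ 2 * (q + p).

(** Used with [r = t - (s + h)], so that [m (r + h)] is the mean entering [u s]. The linear drift of
    the particles over a time [h] compensates the passage of the test function from [P_(r+h) psi] to
    [P_r psi]. *)
Let second_moment_step (r h : R) xi : 0 <= r -> 0 <= h ->
  sg_apply PN h (fun x => m r x ^+ 2) xi <=
    (1 + h * (2 * p)) * m (r + h) xi ^+ 2 + (h * K + remainder * h ^+ 2).
Proof.
move=> r0 h0; have qN0 : 0 <= qN by rewrite mulr_ge0 ?addr_ge0 ?mulr_ge0.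
have := normr_sg_expansion_le config_discrete PN_sg xi qN0 h0 (msqr_le r) fv_generator_exit_le.
rewrite ler_norml => /andP[_ expansion].
have drift := fv_generator_sqr_config_mean_le F_discrete Q_ge0 exit_rate_le p0_ge0 p0_le
  xi N_ge2 (g_le r).
rewrite -/(m r xi) -/(gen r) -/K in drift.
have := m_increment xi r0 h0; have := m_lipschitz xi r0 h0.
have := m_le r xi; have := m_le (r + h) xi.
move: expansion drift; set G := config_mean xi (gen r).
set Lg := fv_generator _ _ _ _; set Pg := sg_apply _ _ _ _.
set a := m r xi; set b := m (r + h) xi => expansion drift b_le a_le lip incr.
have hdrift : h * Lg <= h * (2 * a * G + 2 * p * a ^+ 2 + K) by rewrite ler_wpM2l.
(* Convexity gives [b ^+ 2 >= a ^+ 2 + 2 * a * (b - a)], and [b - a] is [h * G] up to the error in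
   [incr]. *)
have first : a ^+ 2 + 2 * h * a * G <= b ^+ 2 + 8 * c ^+ 2 * (q + p) ^+ 2 * h ^+ 2.
  have : - (a * (b - a - h * G)) <= c * (4 * c * (q + p) ^+ 2 * h ^+ 2).
    by apply: le_trans (ler_norm _) _; rewrite normrN normrM ler_pM.
  by have := sqr_ge0 (a - b); lra.
have second : a ^+ 2 - b ^+ 2 <= 4 * c ^+ 2 * (q + p) * h.
  have : - ((b - a) * (a + b)) <= 2 * c * (q + p) * h * (c + c).
    apply: le_trans (ler_norm _) _; rewrite normrN normrM ler_pM//.
    by rewrite (le_trans (ler_normD _ _))// lerD.
  lra.
have second' : 2 * p * h * (a ^+ 2 - b ^+ 2) <= 2 * p * h * (4 * c ^+ 2 * (q + p) * h).
  by rewrite ler_wpM2l// !mulr_ge0.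
rewrite /remainder; lra.
Qed.

Lemma second_moment_le (eta : config F N) (t : R) : 0 <= t ->
  sg_apply PN t (fun xi => config_mean xi (fun i => psi (Some i)) ^+ 2) eta <=
  expR (2 * p * t) *
    (config_mean eta (fun i => sg_apply P t psi (Some i)) ^+ 2 +
     c ^+ 2 * (4 * q + 16 * p) / N%:R * t).
Proof.
move=> t0.
pose u s := sg_apply PN s (fun xi => m (t - s) xi ^+ 2) eta.
have -> : sg_apply PN t (fun xi => config_mean xi (fun i => psi (Some i)) ^+ 2) eta = u t.
  rewrite /u subrr; congr sg_apply; apply/funext => xi; rewrite /m.
  by congr (config_mean _ _ ^+ 2); apply/funext => i; rewrite /g (sg_apply0 cemetery_discrete P_sg).
have u0 : config_mean eta (fun i => sg_apply P t psi (Some i)) ^+ 2 = u 0.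
  by rewrite /u (sg_apply0 config_discrete PN_sg) subr0.
have K0 : 0 <= K by rewrite divr_ge0// mulr_ge0 ?sqr_ge0// addr_ge0// mulr_ge0.
have D0 : 0 <= remainder.
  have qp0 : 0 <= q + p by rewrite addr_ge0.
  have qN0 : 0 <= qN by rewrite mulr_ge0 ?addr_ge0 ?mulr_ge0.
  by rewrite /remainder; apply: addr_ge0; [apply: addr_ge0|]; do ?apply: mulr_ge0 => //.
rewrite u0; apply: gronwall_euler => //; first by rewrite mulr_ge0.
  by rewrite -u0 sqr_ge0.
(* Chosen so that [remainder * h <= e]; the 1 keeps the denominator positive. *)
move=> e e0; exists (e / (remainder + 1)); first by rewrite divr_gt0// ltr_wpDl.
move=> s h s0 h0 hle sht.
have r0 : 0 <= t - (s + h) by rewrite subr_ge0.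
have rE : t - s = t - (s + h) + h by ring.
have -> : u (s + h) = sg_apply PN s (sg_apply PN h (fun xi => m (t - (s + h)) xi ^+ 2)) eta.
  exact: (sg_apply_comp config_discrete PN_sg _ s0 (ltW h0) (msqr_le _)).
set k := 1 + h * (2 * p).
have kP : sg_apply PN s (fun xi => k * m (t - s) xi ^+ 2 + cst (h * K + remainder * h ^+ 2) xi) eta =
    k * u s + (h * K + remainder * h ^+ 2).
  have kb xi : `|k * m (t - s) xi ^+ 2| <= `|k| * c ^+ 2 by rewrite normrM ler_wpM2l.
  have cb (xi : config F N) : `|cst (h * K + remainder * h ^+ 2) xi| <=
    `|h * K + remainder * h ^+ 2| by [].
  rewrite (sg_applyD config_discrete _ _ _ kb cb) (sg_applyZ config_discrete _ _ _ _ (msqr_le _)).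
  by rewrite (sg_apply_cst config_discrete).
apply: (@le_trans _ _ (k * u s + (h * K + remainder * h ^+ 2))).
  rewrite -kP.
  apply: (@le_sg_apply _ _ _ config_discrete _ _ _ _ (c ^+ 2)
    (`|k| * c ^+ 2 + `|h * K + remainder * h ^+ 2|)) => xi.
  - exact: (fun x => normr_sg_apply_le config_discrete PN h x (msqr_le _)).
  - rewrite (le_trans (ler_normD _ _))// lerD// normrM ler_wpM2l//.
  - by rewrite rE; apply: second_moment_step => //; exact: ltW.
have Dh : remainder * h <= e.
  apply: (le_trans (ler_wpM2l D0 hle)); rewrite mulrCA.
  apply: ler_piMr; first exact: ltW.
  by rewrite ler_pdivrMr ?mul1r ?lerDl// ltr_wpDl.
have : h * (remainder * h) <= h * e by rewrite ler_wpM2l// ltW.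
rewrite /k -/K; lra.
Qed.

End second_moment.

End absorbed_process.

(** * Explicit constants and the passage from the second moment to the first *)

Theorem theorem1p2 (R : realType)
  (d : measure_display) (F : measurableType d)
  (F_countable : countable [set: F])
  (F_discrete : forall A : set F, measurable A)
  (Q : F -> F -> R) (Q_rates : transition_rate_matrix Q)
  (S : R -> R.-pker F ~> F)
  (S_semigroup : markov_semigroup (rate_generator Q) S)
  (S_irreducible : irreducible S)
  (S_positive_recurrent : positive_recurrent S)
  (p0 : F -> R) (p0_ge0 : forall i, 0 <= p0 i) (p0_neq0 : exists i, p0 i != 0)
  (P : R -> R.-pker (with_cemetery F) ~> (with_cemetery F))
  (P_semigroup : markov_semigroup (absorbed_generator Q p0) P)
  (Q1_finite : (ereal_sup (range (exit_rate Q)) < +oo)%E)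
  (p_finite : (ereal_sup (range (EFin \o p0)) < +oo)%E) :
  exists B C : R, [/\ 0 < B, 0 < C &
    forall (N : nat) (t : R) (eta : config F N) (mu : probability F R),
    (2 <= N)%N -> 0 <= t ->
    forall (d' : measure_display) (Omega : measurableType d')
      (Pr : probability Omega R) (X : R -> {mfun Omega >-> config F N}),
    fleming_viot Q p0 Pr X -> started_at Pr X eta ->
    (ereal_sup
       [set 'E_Pr[fun w => `|(\int[empirical (X t w)]_j phi j)%R
                             - conditioned P mu t phi|%R]
       | phi in bounded_by1]
     <= (C * expR (B * t))%:E *
        (((Num.sqrt N%:R)^-1)%:E + dTV (empirical eta) mu))%E].


Proof.
have Q_ge0 := rate_ge0 Q_rates.
have exit_ge0 i : (0%:E <= exit_rate Q i)%E.
  by apply: integral_ge0 => j /=; rewrite eq_sym => ij; rewrite lee_fin Q_ge0.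
have bound (h : F -> \bar R) : (forall i, (0%:E <= h i)%E) ->
    (ereal_sup (range h) < +oo)%E -> exists2 b : R, 0 <= b & forall i, (h i <= b%:E)%E.
  move=> h0 hfin.
  have hle i : (h i <= ereal_sup (range h))%E by apply: ereal_sup_ubound; exists i.
  have sup0 : (0%:E <= ereal_sup (range h))%E by exact: le_trans (hle point).
  exists (fine (ereal_sup (range h))); first exact: fine_ge0.
  by move=> i; rewrite fineK// ge0_fin_numE.
have [q q_ge0 exit_le] := bound _ exit_ge0 Q1_finite.
have [|p p_ge0 p0_le'] := bound (EFin \o p0) _ p_finite; first by move=> i; rewrite lee_fin.
have p0_le i : p0 i <= p by rewrite -lee_fin; exact: p0_le'.
(* The factor [c ^+ 2 * (4 * q + 16 * p)] of the second moment bound, for the bound [c = 2] on the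
   centred function. *)
pose K0 : R := 2 ^+ 2 * (4 * q + 16 * p).
have K0_ge0 : 0 <= K0 by rewrite mulr_ge0// addr_ge0// mulr_ge0.
(* [2 * p] is the Gronwall rate, and the extra 1 lets [expR t] absorb the factor linear in [t]. In
   [17], the 16 is the square of the constant in the initial bound [4 * D], and the 1 comes from the
   term [l / 2] below. *)
exists (2 * p + 1), (17 + K0); split.
- by rewrite ltr_wpDl// mulr_ge0.
- by rewrite ltr_pwDl.
move=> N t eta mu N_ge2 t_ge0 d' Omega Pr X [PN PN_sg PN_X] X0.
have N_pos : (0 < N)%N by exact: leq_trans N_ge2.
have empirical_mass1 : empirical eta [set: F] = 1%E :> \bar R.
  rewrite /empirical; under eq_bigr do rewrite diracT mule1.
  by rewrite sumEFin config_sum_occ -EFinM mulVf// pnatr_eq0 -lt0n.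
have [D D_ge0 DE] := dTV_fin_num_ge0 F_discrete empirical_mass1 (probability_setT mu).
rewrite DE -EFinD -EFinM; apply: ge_ereal_sup => _ [phi phi1 <-].
set c := conditioned P mu t phi.
have [c_le1 centred] := conditioned_centred F_discrete P mu t phi1.
set psi : with_cemetery F -> R := fun x => ext0 phi x - c * alive x.
have psi_None : psi None = 0 by rewrite /psi alive_None mulr0 subr0.
have psi_le x : `|psi x| <= 2.
  rewrite /psi (le_trans (ler_normB _ _))// (_ : 2 = 1 + 1)// lerD//.
    by case: x => [i|] /=; rewrite ?normr0//; exact: phi1.
  by rewrite normrM mulr_ile1// normr_alive.
have psi_Some i : psi (Some i) = phi i - c by rewrite /psi alive_Some mulr1.
pose Y (xi : config F N) := config_mean xi (fun i => psi (Some i)).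
have Y_le xi : `|Y xi| <= 2 by exact: normr_config_mean_le.
have YE xi : `|(\int[empirical xi]_j phi j)%R - c| = `|Y xi|.
  rewrite Rintegral_empirical// /Y; congr `|_|.
  rewrite -[c in LHS](config_mean_cst xi c N_pos) -mulN1r -config_meanZ -config_meanD.
  by congr config_mean; apply/funext => i; rewrite psi_Some mulN1r.
under eq_fun do rewrite YE.
have Y02 y : 0 <= `|Y y| <= 2 by rewrite normr_ge0 Y_le.
rewrite (expectation_jump_process (countable_config N F_countable) _ PN_X X0 t_ge0 Y02)//.
rewrite lee_fin.
pose l := (Num.sqrt N%:R)^-1 + D.
have sN : 0 < (Num.sqrt N%:R)^-1 :> R by rewrite invr_gt0 sqrtr_gt0 ltr0n.
have l_gt0 : 0 < l by rewrite ltr_wpDr.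
have moment := second_moment_le F_discrete Q_ge0 exit_le p0_ge0 p0_le q_ge0 p_ge0 P_semigroup
  N_ge2 PN_sg psi_le psi_None eta t_ge0.
have Pf_le i : `|sg_apply P t psi (Some i)| <= 2.
  exact: (normr_sg_apply_le (cemetery_discrete F_discrete)).
have start : `|config_mean eta (fun i => sg_apply P t psi (Some i))| <= 4 * D.
  have := normr_RintegralB_le_dTV F_discrete empirical_mass1 (probability_setT mu)
    (ltr0n R 2) Pf_le DE.
  by rewrite (Rintegral_empirical F_discrete) centred subr0 (_ : 2 * 2 = 4)//; ring.
set u := sg_apply PN t _ eta in moment.
have u_le : u <= expR (2 * p * t) * ((16 + K0 * t) * l ^+ 2).
  apply: le_trans moment _; rewrite ler_wpM2l ?expR_ge0// [leRHS]mulrDl lerD//.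
    have l4 : 0 <= 4 * l by rewrite mulr_ge0// ltW.
    have Dl : 4 * D <= 4 * l by rewrite ler_wpM2l// lerDr ltW.
    have : `|config_mean eta (fun i => sg_apply P t psi (Some i))| ^+ 2 <= (4 * l) ^+ 2.
      by rewrite lerXn2r ?nnegrE// (le_trans start).
    by rewrite real_normK ?num_real//; lra.
  rewrite -/K0 mulrAC; apply: ler_wpM2l; first exact: mulr_ge0.
  have -> : N%:R^-1 = (Num.sqrt N%:R)^-1 ^+ 2 :> R by rewrite exprVn sqr_sqrtr.
  by apply: lerXn2r; rewrite ?nnegrE ?(ltW sN) ?(ltW l_gt0) ?lerDl.
(* The Cauchy-Schwarz step in pointwise form: weighting by the target size [l] makes both terms of
   order [l] once [Y ^+ 2] is averaged, and uses only positivity and linearity of the semigroup. *)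
have amgm y : `|Y y| <= (2 * l)^-1 * Y y ^+ 2 + cst (l / 2) y.
  have := sqr_ge0 (`|Y y| - l); rewrite sqrrB real_normK ?num_real// => h.
  rewrite (_ : _ + _ = (Y y ^+ 2 + l ^+ 2) / (2 * l)); last by rewrite /=; field; rewrite gt_eqF.
  by rewrite ler_pdivlMr ?mulr_gt0//; lra.
have Y2_le y : `|Y y ^+ 2| <= 4.
  by rewrite normrX (_ : 4 = 2 ^+ 2 :> R); [rewrite lerXn2r ?nnegrE|ring].
have lin : sg_apply PN t (fun y => (2 * l)^-1 * Y y ^+ 2 + cst (l / 2) y) eta =
    (2 * l)^-1 * u + l / 2.
  have kb y : `|(2 * l)^-1 * Y y ^+ 2| <= `|(2 * l)^-1| * 4 by rewrite normrM ler_wpM2l.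
  have cb (y : config F N) : `|cst (l / 2) y| <= `|l / 2| by [].
  rewrite (sg_applyD (@config_discrete _ _ _) _ _ _ kb cb).
  by rewrite (sg_applyZ (@config_discrete _ _ _) _ _ _ _ Y2_le) (sg_apply_cst (@config_discrete _ _ _)).
apply: (@le_trans _ _ ((2 * l)^-1 * u + l / 2)).
  rewrite -lin; apply: (@le_sg_apply _ _ _ (@config_discrete _ _ _) _ _ _ _ 2
    (`|(2 * l)^-1| * 4 + `|l / 2|)) => y //.
  - by rewrite normr_id.
  - by rewrite (le_trans (ler_normD _ _))// lerD// normrM ler_wpM2l.
have E1 : 1 <= expR (2 * p * t) by rewrite -expR0 ler_expR !mulr_ge0.
have E2 : 1 + t <= expR t by exact: expR_ge1Dx.
have {u_le} : (2 * l)^-1 * u <= 2^-1 * (expR (2 * p * t) * (16 + K0 * t) * l).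
  by rewrite mulrC ler_pdivrMr ?mulr_gt0//; lra.
move/(lerD (lexx (l / 2))); rewrite addrC [X in _ <= X -> _]addrC => /le_trans; apply.
rewrite [(2 * p + 1) * t]mulrDl mul1r expRD.
have step : 16 + K0 * t + 1 <= (17 + K0) * expR t.
  have := ler_wpM2l (ltac:(lra) : 0 <= 17 + K0) E2; have := mulr_ge0 K0_ge0 t_ge0; lra.
have : expR (2 * p * t) * (16 + K0 * t + 1) * l <= expR (2 * p * t) * ((17 + K0) * expR t) * l.
  by apply: ler_wpM2r; [exact: ltW|apply: ler_wpM2l; rewrite ?expR_ge0].
have : l <= expR (2 * p * t) * l by rewrite ler_peMl// ltW.
have : 0 <= expR (2 * p * t) * ((17 + K0) * expR t) * l.
  by rewrite !mulr_ge0 ?expR_ge0 ?addr_ge0// ltW.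
rewrite -/l; lra.
Qed.
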